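(* Let $\Phi$ be a $\operatorname{Spin}(7)$-structure on a smooth $8$-manifold $M$, with associated metric $g$, Riemann curvature tensor $R_{ijkl}$ and torsion tensor $T_{m;\alpha\beta}$. Then the following identity (which expresses the diffeomorphism invariance of $T$ as a function of $\Phi$) holds: $$\nabla_{q} T_{p;\alpha\beta} - \nabla_{p} T_{q;\alpha\beta} = \frac{1}{4} R_{pq\alpha\beta} - \frac{1}{8} R_{pqij} g^{ia} g^{jb} \Phi_{ab\alpha\beta} + 2\, T_{q;\alpha m} g^{mn} T_{p;n\beta} - 2\, T_{p;\alpha m} g^{mn} T_{q;n\beta}.$$
   Context: A $\operatorname{Spin}(7)$-structure on a smooth $8$-manifold $M$ (not necessarily compact) is a smooth $4$-form $\Phi$ such that at each point there is a basis $e^1,\dots,e^8$ of the cotangent space in which $\Phi = -\big(e^{1234}+e^{1256}+e^{1278}+e^{3456}+e^{3478}+e^{5678}+e^{1357}-e^{1368}-e^{1458}-e^{1467}-e^{2358}-e^{2367}-e^{2457}+e^{2468}\big)$, where $e^{ijkl}=e^i\wedge e^j\wedge e^k\wedge e^l$. It determines a Riemannian metric $g=g_\Phi$ and an orientation, for which such a basis is oriented orthonormal; then $\ast\Phi=\Phi$. In local coordinates $\Phi=\frac1{24}\Phi_{ijkl}dx^i\wedge dx^j\wedge dx^k\wedge dx^l$, repeated indices are summed, and the sign convention is such that $\Phi_{ijkl}\Phi_{abcd}g^{kc}g^{ld}=6g_{ia}g_{jb}-6g_{ib}g_{ja}-4\Phi_{ijab}$. $\nabla$ is the Levi-Civita connection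 of $g$. $\Omega^2_7=\{\beta\in\Omega^2: \ast(\Phi\wedge\beta)=-3\beta\}$, equivalently $\beta_{ab}g^{ap}g^{bq}\Phi_{pqij}=-6\beta_{ij}$. Torsion tensor: it is known that for each $m$ there is a unique $T_{m;ab}$, lying in $\Omega^2_7$ as a skew tensor in $a,b$, with $\nabla_m\Phi_{ijkl}=T_{m;ip}g^{pq}\Phi_{qjkl}+T_{m;jp}g^{pq}\Phi_{iqkl}+T_{m;kp}g^{pq}\Phi_{ijql}+T_{m;lp}g^{pq}\Phi_{ijkq}$; the tensor $T$ is the torsion tensor of $\Phi$. Curvature convention: $R_{ijkl}=g\big((\nabla_i\nabla_j-\nabla_j\nabla_i)\partial_k,\partial_l\big)$ for coordinate vector fields, so that the Ricci tensor is $R_{jk}=R_{ijkl}g^{il}$. *)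

(* Defs.v *)
From HB Require Import structures.
From mathcomp Require Import all_boot all_order all_algebra all_fingroup.
From mathcomp Require Import all_classical all_reals all_analysis.

Set Implicit Arguments.
Unset Strict Implicit.
Unset Printing Implicit Defensive.

Import Order.TTheory GRing.Theory Num.Theory.
Import numFieldNormedType.Exports.

Local Open Scope classical_set_scope.
Local Open Scope ring_scope.

(** ** Smooth functions on open subsets of R^n *)

Definition partial (R : realType) (n : nat) (i : 'I_n)
    (f : 'rV[R]_n -> R) : 'rV[R]_n -> R :=
  fun x => 'D_(delta_mx 0 i : 'rV[R]_n) f x.

Fixpoint Ck_on (R : realType) (n k : nat) (U : set 'rV[R]_n)
    (f : 'rV[R]_n -> R) : Prop :=
  (forall x, U x -> {for x, continuous f}) /\
  match k with
  | 0 => True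
  | k'.+1 => forall i : 'I_n,
      (forall x, U x -> derivable f x (delta_mx 0 i : 'rV[R]_n)) /\
      Ck_on k' U (partial i f)
  end.

Definition smooth_on (R : realType) (n : nat) (U : set 'rV[R]_n)
    (f : 'rV[R]_n -> R) : Prop :=
  forall k, Ck_on k U f.

(** ** Smooth manifolds *)

(* [chart_map] and [chart_inv] are total functions; only their values on
   [chart_dom], respectively [chart_cod], are meaningful. *)
Record chart (R : realType) (n : nat) (M : topologicalType) := Chart {
  chart_dom : set M;
  chart_cod : set 'rV[R]_n;
  chart_map : M -> 'rV[R]_n;
  chart_inv : 'rV[R]_n -> M;
  chart_dom_open : open chart_dom;
  chart_cod_open : open chart_cod;
  chart_mapP : forall p, chart_dom p -> chart_cod (chart_map p);
  chart_invP : forall x, chart_cod x -> chart_dom (chart_inv x);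
  chart_mapK : forall p, chart_dom p -> chart_inv (chart_map p) = p;
  chart_invK : forall x, chart_cod x -> chart_map (chart_inv x) = x;
  chart_map_continuous : {within chart_dom, continuous chart_map};
  chart_inv_continuous : {within chart_cod, continuous chart_inv}
}.

Section Transition.
Variables (R : realType) (n : nat) (M : topologicalType).
Implicit Types c d : chart R n M.

Definition transition c d : 'rV[R]_n -> 'rV[R]_n :=
  fun x => chart_map d (chart_inv c x).

Definition overlap c d : set 'rV[R]_n :=
  [set x | chart_cod c x /\ chart_dom d (chart_inv c x)].

End Transition.

(* The atlas need not be maximal; being a set of charts, it may be. *)
Record smooth_manifold (R : realType) (n : nat) := SmoothManifold {
  carrier :> topologicalType;
  carrier_hausdorff : hausdorff_space carrier;
  carrier_second_countable : @second_countable carrier;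
  atlas : set (chart R n carrier);
  atlas_cover : forall p : carrier, exists2 c, atlas c & chart_dom c p;
  atlas_smooth : forall c d, atlas c -> atlas d -> forall i : 'I_n,
    smooth_on (overlap c d) (fun x => transition c d x 0 i)
}.

(** ** Tensor calculus in local coordinates *)

(* [S [tuple i1; ...; ik] x] is the component S_{i1...ik} at the point with
   coordinates x. *)
Definition components (R : realType) (n k : nat) : Type :=
  k.-tuple 'I_n -> 'rV[R]_n -> R.

Section LocalTensors.
Variables (R : realType) (n : nat).
Implicit Types (g : components R n 2) (x : 'rV[R]_n).

Definition metric_mx g x : 'M[R]_n := \matrix_(i, j) g [tuple i; j] x.

Definition metric_inv g x : 'M[R]_n := invmx (metric_mx g x).

(* [christoffel g s i j x] is Gamma^s_{ij}, so that the Levi-Civita connection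
   is nabla_i d_j = Gamma^s_{ij} d_s. *)
Definition christoffel g (s i j : 'I_n) x : R :=
  2^-1 * \sum_(l < n) metric_inv g x s l *
    (partial i (g [tuple j; l]) x + partial j (g [tuple i; l]) x
     - partial l (g [tuple i; j]) x).

Definition replace_index (k : nat) (I : k.-tuple 'I_n) (r : 'I_k) (s : 'I_n) :
    k.-tuple 'I_n :=
  [tuple if r' == r then s else tnth I r' | r' < k].

(* nabla_m S_{i1...ik} *)
Definition cov_deriv (k : nat) g (S : components R n k) (m : 'I_n)
    (I : k.-tuple 'I_n) x : R :=
  partial m (S I) x
  - \sum_(r < k) \sum_(s < n)
      christoffel g s m (tnth I r) x * S (replace_index I r s) x.

(* Vector fields are given by their components, X = X^s d_s. *)
Definition coord_field (i : 'I_n) : 'I_n -> 'rV[R]_n -> R :=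
  fun s _ => (s == i)%:R.

Definition cov_deriv_field g (i : 'I_n) (X : 'I_n -> 'rV[R]_n -> R) :
    'I_n -> 'rV[R]_n -> R :=
  fun s x => partial i (X s) x + \sum_(t < n) christoffel g s i t x * X t x.

(* R_{ijkl} = g((nabla_i nabla_j - nabla_j nabla_i) d_k, d_l) *)
Definition riemann g (i j k l : 'I_n) x : R :=
  \sum_(s < n) g [tuple s; l] x *
    (cov_deriv_field g i (cov_deriv_field g j (coord_field k)) s x
     - cov_deriv_field g j (cov_deriv_field g i (coord_field k)) s x).

End LocalTensors.

(** ** Tensor fields on a manifold *)

(* A family of components, one for each chart; only its values at charts c of
   the atlas and at points of [chart_cod c] are meaningful. *)
Definition tensor_components (R : realType) (n : nat) (M : smooth_manifold R n)
    (k : nat) : Type :=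
  chart R n M -> components R n k.

Section Tensors.
Variables (R : realType) (n : nat) (M : smooth_manifold R n).

Definition smooth_tensor (k : nat) (S : tensor_components M k) : Prop :=
  (forall c I, atlas c -> smooth_on (chart_cod c) (S c I)) /\
  (forall c d I x, atlas c -> atlas d -> overlap c d x ->
     S c I x =
     \sum_(J : k.-tuple 'I_n) S d J (transition c d x) *
       \prod_(r < k)
         partial (tnth I r) (fun z => transition c d z 0 (tnth J r)) x).

Definition smooth_form (k : nat) (w : tensor_components M k) : Prop :=
  smooth_tensor w /\
  forall c I x (s : 'S_k), atlas c -> chart_cod c x ->
    w c [tuple tnth I (s r) | r < k] x = (-1) ^+ s * w c I x.

Definition riemannian_metric (g : tensor_components M 2) : Prop :=
  [/\ smooth_tensor g,
      forall c i j x, atlas c -> chart_cod c x ->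
        g c [tuple i; j] x = g c [tuple j; i] x &
      forall c x (v : 'rV[R]_n), atlas c -> chart_cod c x -> v != 0 ->
        0 < \sum_(i < n) \sum_(j < n) g c [tuple i; j] x * v 0 i * v 0 j].

End Tensors.

(** ** Spin(7)-structures *)

Section Spin7Model.
Variable R : realType.

(* The coframe e^1, ..., e^8 is the matrix E whose row a-1 lists the
   components of e^a; [coframe4 E I a b c d] is the component of index I of
   e^a /\ e^b /\ e^c /\ e^d, with 1 <= a, b, c, d <= 8. *)
Definition coframe4 (E : 'M[R]_8) (I : 4.-tuple 'I_8) (a b c d : nat) : R :=
  \det (mxsub
    (tnth [tuple inord a.-1 : 'I_8; inord b.-1; inord c.-1; inord d.-1])
    (tnth I) E).

Definition spin7_form (E : 'M[R]_8) (I : 4.-tuple 'I_8) : R :=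
  - (coframe4 E I 1 2 3 4 + coframe4 E I 1 2 5 6 + coframe4 E I 1 2 7 8
     + coframe4 E I 3 4 5 6 + coframe4 E I 3 4 7 8 + coframe4 E I 5 6 7 8
     + coframe4 E I 1 3 5 7 - coframe4 E I 1 3 6 8 - coframe4 E I 1 4 5 8
     - coframe4 E I 1 4 6 7 - coframe4 E I 2 3 5 8 - coframe4 E I 2 3 6 7
     - coframe4 E I 2 4 5 7 + coframe4 E I 2 4 6 8).

End Spin7Model.

Section Spin7.
Variables (R : realType) (M : smooth_manifold R 8).

Definition adapted_coframe (Phi : tensor_components M 4) (c : chart R 8 M)
    (x : 'rV[R]_8) (E : 'M[R]_8) : Prop :=
  E \in unitmx /\ forall I, Phi c I x = spin7_form E I.

Definition spin7_structure (Phi : tensor_components M 4) : Prop :=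
  smooth_form Phi /\
  forall c x, atlas c -> chart_cod c x -> exists E, adapted_coframe Phi c x E.

(* g = g_Phi: at each point some adapted coframe is g-orthonormal. All adapted
   coframes at a point then are, since they differ by elements of
   Spin(7), which is contained in SO(8). *)
Definition spin7_metric (Phi : tensor_components M 4)
    (g : tensor_components M 2) : Prop :=
  riemannian_metric g /\
  forall c x, atlas c -> chart_cod c x -> exists E,
    adapted_coframe Phi c x E /\
    forall i j, g c [tuple i; j] x = \sum_(a < 8) E a i * E a j.

(* Pointwise Omega^2_7, for the metric with inverse matrix [h]. *)
Definition Omega2_7 (h : 'M[R]_8) (P : 4.-tuple 'I_8 -> R)
    (beta : 'I_8 -> 'I_8 -> R) : Prop :=
  (forall i j, beta i j = - beta j i) /\
  forall i j,
    \sum_(a < 8) \sum_(b < 8) \sum_(p < 8) \sum_(q < 8)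
      beta a b * h a p * h b q * P [tuple p; q; i; j] = - 6 * beta i j.

(* Smoothness of T and its transformation law are not required: T is uniquely
   determined by these pointwise conditions, which imply both. *)
Definition torsion_tensor (Phi : tensor_components M 4)
    (g : tensor_components M 2) (T : tensor_components M 3) : Prop :=
  forall c x, atlas c -> chart_cod c x ->
  let h := metric_inv (g c) x in
  forall m : 'I_8,
    Omega2_7 h (fun I => Phi c I x) (fun a b => T c [tuple m; a; b] x) /\
    forall i j k l : 'I_8,
      cov_deriv (g c) (Phi c) m [tuple i; j; k; l] x =
      \sum_(p < 8) \sum_(q < 8)
        (T c [tuple m; i; p] x * h p q * Phi c [tuple q; j; k; l] x
         + T c [tuple m; j; p] x * h p q * Phi c [tuple i; q; k; l] x
         + T c [tuple m; k; p] x * h p q * Phi c [tuple i; j; q; l] x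
         + T c [tuple m; l; p] x * h p q * Phi c [tuple i; j; k; q] x).

End Spin7.

(* Main.v *)
Require Import Defs.
From HB Require Import structures.
From mathcomp Require Import all_boot all_order all_algebra all_fingroup.
From mathcomp Require Import all_classical all_reals all_analysis.
From mathcomp Require Import ring lra.
Import Order.TTheory GRing.Theory Num.Theory.
Import numFieldNormedType.Exports.
Local Open Scope ring_scope.

Set Implicit Arguments.
Unset Strict Implicit.
Unset Printing Implicit Defensive.

(* Let Gamma_m be the matrix of Christoffel symbols, h the inverse metric and
   A.Phi the derivation action of an endomorphism A on Phi. The torsion equation
   says d_m Phi = (Gamma_m + T_m h).Phi, so Gamma + T h is a connection
   preserving Phi, and the symmetry of second derivatives makes its curvature F
   annihilate Phi. Contracting F.Phi = 0 with Phi shows that the 2-form of F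
   lies in Omega^2_21, i.e. is a 2-eigenvector of beta |-> Phi(beta). That
   2-form is D - R_pq + [T_p, T_q], where D is the left-hand side. On the other
   hand, differentiating the Omega^2_7 condition on T shows that
   nabla_q T_p + [T_p, T_q] is a (-6)-eigenvector, and [T_p, T_q] lies in
   Omega^2_21 because [Omega^2_7, Omega^2_7] does. The three eigenvector
   equations together determine D.

   All pointwise algebra follows from the octonionic form of Phi: in an adapted
   coframe, Phi_ijkl = g_ik g_jl - g_il g_jk - sum_a (J_a)_ij (J_a)_kl for seven
   orthogonal complex structures J_a spanning Omega^2_7. Contracting
   d_m Phi - Gamma_m.Phi = (T_m h).Phi with Phi gives 96 T_m, which is why T is
   differentiable. *)

(** * The model form *)

Section Minors.
Variable R : comRingType.
Implicit Types u v w z : nat -> R.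

Definition minor2 u v a b := u a * v b - u b * v a.

(** The Laplace expansion of a 4 by 4 minor along its first two columns [u] and [v]. It turns the 14
    determinants of the model form into polynomials that [ring] can compare. *)
Definition minor4 u v w z a b c d :=
    minor2 u v a b * minor2 w z c d - minor2 u v a c * minor2 w z b d
  + minor2 u v a d * minor2 w z b c + minor2 u v b c * minor2 w z a d
  - minor2 u v b d * minor2 w z a c + minor2 u v c d * minor2 w z a b.

Lemma det_mx44 (A : 'M[R]_4) :
  let col k i := A (inord i) (inord k) in
  \det A = minor4 (col 0) (col 1) (col 2) (col 3) 0 1 2 3.
Proof.
(* Entries are read off a literal list, so that the nested lifted ordinals produced by the cofactor
   expansions reduce by computation. *)
move=> col; have AE i (j : 'I_4) : A i j = nth 0 [seq col k i | k <- iota 0 4] j.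
  by rewrite (nth_map 0) ?size_iota // nth_iota // /col !inord_val.
do 3 rewrite !(expand_det_row _ ord0) !big_ord_recl !big_ord0 /cofactor.
rewrite !det_mx11 !mxE !AE /= /minor4 /minor2 /bump /= !(add0n, addn0, add1n).
by rewrite /=; ring.
Qed.

End Minors.

(* The entry in row i and column j is a when (J_a)_ij = 1 and a + 8 when
   (J_a)_ij = -1; the matrices J_1, ..., J_7 are the octonionic complex
   structures (J_a)_ij = d_0i d_aj - d_0j d_ai - Phi_0aij of the model. *)
Definition unit_table : seq (seq nat) :=
  [:: [::  0;  1;  2;  3;  4;  5;  6;  7];
      [::  9;  0;  3; 10;  5; 12;  7; 14];
      [:: 10; 11;  0;  1;  6; 15; 12;  5];
      [:: 11;  2;  9;  0; 15; 14;  5;  4];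
      [:: 12; 13; 14;  7;  0;  1;  2; 11];
      [:: 13;  4;  7;  6;  9;  0; 11; 10];
      [:: 14; 15;  4; 13; 10;  3;  0;  1];
      [:: 15;  6; 13; 12;  3;  2;  9;  0]]%N.

Definition unit_entry (R : pzRingType) (a i j : nat) : R :=
  let s := nth 0%N (nth [::] unit_table i) j in (s == a)%:R - (s == a + 8)%N%:R.

(** The index is shifted: [imag_unit R a] is J_(a+1). The entry 0 of the table, found on the
    diagonal, then matches none of the seven units and stands for a vanishing coefficient. *)
Definition imag_unit (R : pzRingType) (a : 'I_7) : 'M[R]_8 :=
  \matrix_(i, j) unit_entry R a.+1 i j.

(** Identities between the J_a are decided by evaluation over [int] and then transported to R along
    the canonical morphism. *)
Lemma unit_entry_int (R : pzRingType) a i j :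
  unit_entry R a i j = (unit_entry int a i j)%:~R.
Proof. by rewrite /unit_entry rmorphB /= !rmorph_nat. Qed.

Lemma imag_unit_skew (R : pzRingType) a : (imag_unit R a)^T = - imag_unit R a.
Proof.
have H : all (fun a => all (fun i => all (fun j =>
   unit_entry int a j i == - unit_entry int a i j) (iota 0 8)) (iota 0 8)) (iota 1 7).
  by vm_compute.
apply/matrixP => i j; rewrite !mxE unit_entry_int [in RHS]unit_entry_int -rmorphN.
have /(allP H)/allP/(_ (val i)) : a.+1 \in iota 1 7.
  by rewrite mem_iota; exact: (ltn_ord a).
rewrite mem_iota add0n ltn_ord => /(_ isT)/allP/(_ (val j)).
by rewrite mem_iota add0n ltn_ord => /(_ isT)/eqP ->.
Qed.

Lemma mxtrace_imag_unit2 (R : pzRingType) a b :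
  \tr (imag_unit R a *m imag_unit R b) = - 8 * (a == b)%:R.
Proof.
have H : all (fun a => all (fun b =>
    \sum_(0 <= i < 8) \sum_(0 <= j < 8) unit_entry int a i j * unit_entry int b j i
    == - 8 * (a == b)%:R) (iota 1 7)) (iota 1 7).
  (* Unlocking turns the big operators into folds that evaluate. *)
  by rewrite unlock; vm_compute.
have /(allP H)/allP/(_ (val b).+1) : a.+1 \in iota 1 7.
  by rewrite mem_iota; exact: (ltn_ord a).
rewrite mem_iota => /(_ (ltn_ord b))/eqP/(congr1 (fun n : int => n%:~R : R)).
rewrite rmorphM /= rmorph_nat => <-; rewrite big_mkord rmorph_sum.
apply: eq_bigr => i _; rewrite !mxE big_mkord rmorph_sum.
by apply: eq_bigr => j _; rewrite !mxE rmorphM /= -!unit_entry_int.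
Qed.

(** This makes every product J_b J_c, hence every commutator, trace-orthogonal to Omega^2_7. It is
    the source of the inclusion of [Omega^2_7, Omega^2_7] in Omega^2_21. *)
Lemma mxtrace_imag_unit3 (R : pzRingType) a b c :
  \tr (imag_unit R a *m (imag_unit R b *m imag_unit R c)) = 0.
Proof.
have H : all (fun a => all (fun b => all (fun c =>
    \sum_(0 <= i < 8) \sum_(0 <= j < 8) unit_entry int a i j *
      (\sum_(0 <= k < 8) unit_entry int b j k * unit_entry int c k i)
    == 0) (iota 1 7)) (iota 1 7)) (iota 1 7).
  by rewrite unlock; vm_compute.
have /(allP H)/allP/(_ (val b).+1) : a.+1 \in iota 1 7.
  by rewrite mem_iota; exact: (ltn_ord a).
rewrite mem_iota => /(_ (ltn_ord b))/allP/(_ (val c).+1).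
rewrite mem_iota => /(_ (ltn_ord c))/eqP/(congr1 (fun n : int => n%:~R : R)).
move=> tr0; apply: etrans tr0; rewrite big_mkord rmorph_sum.
apply: eq_bigr => i _; rewrite !mxE big_mkord rmorph_sum.
apply: eq_bigr => j _; rewrite !mxE big_mkord rmorphM rmorph_sum /= -unit_entry_int.
congr (_ * _).
by apply: eq_bigr => k _; rewrite !mxE rmorphM /= -!unit_entry_int.
Qed.

Lemma coframe4E (R : realType) (E : 'M[R]_8) (i j k l : 'I_8) a b c d :
  coframe4 E [tuple i; j; k; l] a b c d =
  minor4 (fun n => E (inord n) i) (fun n => E (inord n) j)
         (fun n => E (inord n) k) (fun n => E (inord n) l) a.-1 b.-1 c.-1 d.-1.
Proof.
by rewrite /coframe4 det_mx44 /minor4 /minor2 !mxE !(tnth_nth ord0) !inordK.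
Qed.

(** The octonionic form of Phi, pulled back by the coframe. Once the sums and the table are written
    out, both sides are explicit polynomials in the entries of the columns i, j, k, l of E. *)
Lemma spin7_formE (R : realType) (E : 'M[R]_8) (i j k l : 'I_8) :
  let G := E^T *m E in let K a := E^T *m imag_unit R a *m E in
  spin7_form E [tuple i; j; k; l]
  = G i k * G j l - G i l * G j k - \sum_a K a i j * K a k l.
Proof.
move=> G K; pose e i n := E (inord n) i.
have GE i' k' : G i' k' = \sum_(0 <= n < 8) e i' n * e k' n.
  by rewrite mxE big_mkord; apply: eq_bigr => n _; rewrite mxE /e inord_val.
have KE a i' k' : K a i' k' = \sum_(0 <= n < 8) \sum_(0 <= m < 8)
    unit_entry R a.+1 m n * e i' m * e k' n.
  rewrite mxE big_mkord; apply: eq_bigr => n _; rewrite mxE mulr_suml big_mkord.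
  by apply: eq_bigr => m _; rewrite !mxE /e !inord_val; ring.
rewrite /spin7_form !coframe4E -!/(e _) !GE.
have -> : \sum_a K a i j * K a k l =
  \sum_(0 <= a < 7) (\sum_(0 <= n < 8) \sum_(0 <= m < 8)
    unit_entry R a.+1 m n * e i m * e j n) * (\sum_(0 <= n < 8) \sum_(0 <= m < 8)
    unit_entry R a.+1 m n * e k m * e l n).
  by rewrite big_mkord; apply: eq_bigr => a _; rewrite !KE.
rewrite unlock /unit_entry /= !mulr0n !mulr1n /minor4 /minor2.
ring.
Qed.

(** * Pointwise algebra of Spin(7)-forms *)

Section Tensor4.
Variable R : realFieldType.
Implicit Types (A t : 'M[R]_8) (S P : 'I_8 -> 'I_8 -> 'I_8 -> 'I_8 -> R).

(** The operator beta |-> Phi(beta) of the Omega^2_7 condition, for an argument whose indices are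
    already raised: it is applied to [h *m B *m h]. *)
Definition contract12 P t : 'M[R]_8 :=
  \matrix_(i, j) \sum_a \sum_b t a b * P a b i j.

Definition deriv_act A S : 'I_8 -> 'I_8 -> 'I_8 -> 'I_8 -> R :=
  fun i j k l => \sum_q (A i q * S q j k l + A j q * S i q k l
                         + A k q * S i j q l + A l q * S i j k q).

(** P_b with its last three indices raised. The matrix product for two of them lets
    [derivable_mulmx] apply later. *)
Definition raise3 (h : 'M[R]_8) P b j k l : R :=
  \sum_j' h j j' * (h *m (\matrix_(k', l') P b j' k' l') *m h) k l.

Lemma contract12D P t1 t2 : contract12 P (t1 + t2) = contract12 P t1 + contract12 P t2.
Proof.
apply/matrixP => i j; rewrite !mxE -big_split; apply: eq_bigr => a _.
by rewrite -big_split; apply: eq_bigr => b _; rewrite mxE mulrDl.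
Qed.

Lemma contract12N P t : contract12 P (- t) = - contract12 P t.
Proof.
apply/matrixP => i j; rewrite !mxE -sumrN; apply: eq_bigr => a _.
by rewrite -sumrN; apply: eq_bigr => b _; rewrite mxE mulNr.
Qed.

End Tensor4.

(** What the pointwise algebra retains of an adapted coframe; [K a] is the 2-form of a complex
    structure, with both indices lowered. The formula for [P] shows skewness inside each pair of
    indices and symmetry between the pairs; [spin7_swap] adds the remaining adjacent transposition,
    whence full antisymmetry. *)
Record spin7_algebra (R : realFieldType) (G h : 'M[R]_8)
    (P : 'I_8 -> 'I_8 -> 'I_8 -> 'I_8 -> R) (K : 'I_7 -> 'M[R]_8) : Prop := {
  spin7_sym : G^T = G;
  spin7_Gh : G *m h = 1%:M;
  spin7_skew : forall a, (K a)^T = - K a;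
  spin7_formK : forall i j k l,
    P i j k l = G i k * G j l - G i l * G j k - \sum_a K a i j * K a k l;
  spin7_swap : forall i j k l, P i k j l = - P i j k l;
  spin7_trace2 : forall a b,
    \tr (K a *m h *m K b *m h) = - 8 * (a == b)%:R;
  spin7_trace3 : forall a b c, \tr (K a *m h *m K b *m h *m K c *m h) = 0 }.

Section Pointwise.
Variables (R : realFieldType) (G h : 'M[R]_8).
Variables (P : 'I_8 -> 'I_8 -> 'I_8 -> 'I_8 -> R) (K : 'I_7 -> 'M[R]_8).
Hypothesis alg : spin7_algebra G h P K.
Implicit Types (A B : 'M[R]_8).

Let Gt := spin7_sym alg.
Let Gh := spin7_Gh alg.
Let Kt := spin7_skew alg.

Let hG : h *m G = 1%:M. Proof. exact: mulmx1C Gh. Qed.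

Let ht : h^T = h.
Proof. by rewrite -[LHS]mul1mx -hG -mulmxA -{1}Gt -trmx_mul hG trmx1 mulmx1. Qed.

Let GC i j : G i j = G j i. Proof. by rewrite -{1}Gt mxE. Qed.
Let hC i j : h i j = h j i. Proof. by rewrite -{1}ht mxE. Qed.
Let KN a i j : K a i j = - K a j i.
Proof. by have /matrixP/(_ j i) := Kt a; rewrite !mxE. Qed.

Let trN (A : 'M[R]_8) : \tr (- A) = - \tr A. Proof. exact: raddfN. Qed.

Lemma spin7_skew34 i j k l : P i j l k = - P i j k l.
Proof.
rewrite !(spin7_formK alg) [in LHS](eq_bigr (fun a => - (K a i j * K a k l))).
  by rewrite sumrN; ring.
by move=> a _; rewrite [K a l k]KN mulrN.
Qed.

Lemma spin7_pair i j k l : P k l i j = P i j k l.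
Proof.
rewrite !(spin7_formK alg) (GC k i) (GC l j) (GC k j) (GC l i).
by congr (_ - _); [ring | apply: eq_bigr => a _; rewrite mulrC].
Qed.

Lemma contract12_spin7 t :
  contract12 P t = G *m t *m G - (G *m t *m G)^T - \sum_a \tr (t *m (K a)^T) *: K a.
Proof.
have GtG i j : (G *m t *m G) i j = \sum_a \sum_b t a b * (G a i * G b j).
  rewrite mxE exchange_big; apply: eq_bigr => b _; rewrite mxE mulr_suml.
  by apply: eq_bigr => a _; rewrite (GC i a); ring.
have entryE (X Y Z : 'M[R]_8) i j : (X - Y^T - Z) i j = X i j - Y j i - Z i j.
  by rewrite !mxE.
apply/matrixP => i j; rewrite entryE summxE mxE !GtG.
have -> : \sum_a (\tr (t *m (K a)^T) *: K a) i j
    = \sum_b \sum_c t b c * \sum_a K a b c * K a i j.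
  transitivity (\sum_a \sum_b \sum_c t b c * (K a b c * K a i j)).
    apply: eq_bigr => a _; rewrite mxE mulr_suml; apply: eq_bigr => b _.
    by rewrite mxE mulr_suml; apply: eq_bigr => c _; rewrite mxE mulrA.
  rewrite exchange_big; apply: eq_bigr => b _; rewrite exchange_big.
  by apply: eq_bigr => c _; rewrite mulr_sumr.
rewrite -!sumrB; apply: eq_bigr => a _; rewrite -!sumrB; apply: eq_bigr => b _.
by rewrite (spin7_formK alg); ring.
Qed.

(** For skew B the right-hand side is 2 B minus 8 times the orthogonal projection of B to the span
    of the [K a]. Hence the eigenvalues: 2 - 8 = -6 on the span, which is Omega^2_7, and 2 on its
    orthogonal complement Omega^2_21. *)
Lemma contract12_sharp B : contract12 P (h *m B *m h)
  = B - B^T - \sum_a \tr (h *m B *m h *m (K a)^T) *: K a.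
Proof.
by rewrite contract12_spin7 !mulmxA Gh mul1mx -[B *m h *m G]mulmxA hG mulmx1.
Qed.

Lemma contract12_unit c : contract12 P (h *m K c *m h) = - 6 *: K c.
Proof.
rewrite contract12_sharp Kt opprK (bigD1 c) //= big1 ?addr0.
  rewrite Kt mulmxN trN -!mulmxA mxtrace_mulC !mulmxA (spin7_trace2 alg).
  rewrite eqxx -(scale1r (K c)) !scalerA -scalerDl -scalerBl.
  by congr (_ *: _); rewrite !mulr1n; ring.
move=> a ac; rewrite Kt mulmxN trN -!mulmxA mxtrace_mulC !mulmxA.
by rewrite (spin7_trace2 alg) eq_sym (negPf ac) mulr0 oppr0 scale0r.
Qed.

(** The contraction rule for Phi with itself. For the 2-form B = P_ab, [contract12_sharp] gives 2 B
    + 6 sum_c (K_c)_ab K_c, and the octonionic form replaces the sum by metric terms minus P,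
    leaving 2 - 6 = -4 times P. *)
Lemma contract12_double a b i j :
  contract12 P (h *m (\matrix_(k, l) P a b k l) *m h) i j
  = 6 * (G a i * G b j - G a j * G b i) - 4 * P a b i j.
Proof.
set B := \matrix_(k, l) _.
have Bt : B^T = - B by apply/matrixP => k l; rewrite !mxE spin7_skew34.
(* Pairing P_ab with K_c is, by the symmetry between index pairs, the (a, b) entry of Phi(K_c) = -6
   K_c. *)
have trE c : \tr (h *m B *m h *m (K c)^T) = - 6 * K c a b.
  transitivity (contract12 P (h *m K c *m h) a b); last by rewrite contract12_unit mxE.
  rewrite -mxtrace_tr !trmx_mul trmxK ht !mulmxA mxtrace_mulC !mulmxA.
  rewrite /mxtrace [RHS]mxE.
  apply: eq_bigr => k _; rewrite mxE; apply: eq_bigr => l _.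
  by rewrite !mxE spin7_pair.
have entryE (X Y Z : 'M[R]_8) : (X + Y - Z) i j = X i j + Y i j - Z i j.
  by rewrite !mxE.
rewrite contract12_sharp Bt opprK entryE summxE.
rewrite (eq_bigr (fun c => - 6 * (K c a b * K c i j))); last first.
  by move=> c _; rewrite mxE trE mulrA.
rewrite -mulr_sumr !mxE.
have := spin7_formK alg a b i j; lra.
Qed.

Lemma raise3_skew12 b j k l : raise3 h P b k j l = - raise3 h P b j k l.
Proof.
have raiseE j' k' : raise3 h P b j' k' l =
    \sum_m \sum_n h j' m * h k' n * \sum_s P b m n s * h s l.
  apply: eq_bigr => m _; rewrite -mulmxA mxE mulr_sumr; apply: eq_bigr => n _.
  rewrite mxE -mulrA; congr (_ * (_ * _)).
  by apply: eq_bigr => s _; rewrite !mxE.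
rewrite !raiseE exchange_big -sumrN; apply: eq_bigr => m _.
rewrite -sumrN; apply: eq_bigr => n _.
rewrite (eq_bigr (fun s => - (P b m n s * h s l))).
  by rewrite sumrN; ring.
by move=> s _; rewrite (spin7_swap alg) mulNr.
Qed.

Lemma raise3_skew23 b j k l : raise3 h P b j l k = - raise3 h P b j k l.
Proof.
rewrite -sumrN; apply: eq_bigr => m _; rewrite -mulrN; congr (_ * _).
set B := \matrix_(_, _) _.
have Bt : B^T = - B by apply/matrixP => i i'; rewrite !mxE spin7_skew34.
have /matrixP/(_ k l) : (h *m B *m h)^T = - (h *m B *m h).
  by rewrite !trmx_mul ht Bt mulNmx mulmxN mulmxA.
by rewrite !mxE.
Qed.

Lemma raise3_contract i q b j :
  \sum_k \sum_l P i q k l * raise3 h P b j k l =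
  6 * (G b i * (j == q)%:R - G b q * (j == i)%:R) - 4 * \sum_m h j m * P b m i q.
Proof.
transitivity (\sum_m h j m * contract12 P (h *m (\matrix_(k, l) P b m k l) *m h) i q).
  under eq_bigr do under eq_bigr do rewrite mulr_sumr.
  under eq_bigr do rewrite exchange_big.
  rewrite exchange_big; apply: eq_bigr => m _; rewrite mxE mulr_sumr.
  apply: eq_bigr => k _; rewrite mulr_sumr; apply: eq_bigr => l _.
  by rewrite (spin7_pair i q k l); ring.
have d s : (j == s)%:R = \sum_m h j m * G m s.
  by have /matrixP/(_ j s) := hG; rewrite !mxE.
rewrite !d !mulr_sumr -sumrB mulr_sumr -sumrB; apply: eq_bigr => m _.
by rewrite contract12_double; ring.
Qed.

(** The first slot of A.P contributes 42 A G. By antisymmetry each of the other three contributes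
    the same [t2] = 6 tr(A) G - 6 A G - 4 Phi(A G). Hence 24 = 42 - 18, 18 = 3 . 6 and 12 = 3 .
    4. *)
Lemma deriv_act_contract A i b :
  \sum_j \sum_k \sum_l deriv_act A P i j k l * raise3 h P b j k l
  = 24 * (A *m G) i b + 18 * \tr A * G i b
    - 12 * contract12 P (h *m (A *m G) *m h) i b.
Proof.
pose U := raise3 h P b.
pose t2 := \sum_j \sum_q A j q * \sum_k \sum_l P i q k l * U j k l.
have -> : \sum_j \sum_k \sum_l deriv_act A P i j k l * U j k l
    = \sum_q A i q * (\sum_j \sum_k \sum_l P q j k l * U j k l) + 3 * t2.
  transitivity
    (\sum_j \sum_k \sum_l \sum_q A i q * P q j k l * U j k l
     + \sum_j \sum_k \sum_l \sum_q A j q * P i q k l * U j k l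
     + \sum_j \sum_k \sum_l \sum_q A k q * P i j q l * U j k l
     + \sum_j \sum_k \sum_l \sum_q A l q * P i j k q * U j k l).
    rewrite -!big_split; apply: eq_bigr => j _; rewrite -!big_split /=.
    apply: eq_bigr => k _; rewrite -!big_split /=; apply: eq_bigr => l _.
    rewrite -!big_split /= mulr_suml; apply: eq_bigr => q _; ring.
  have e1 : \sum_j \sum_k \sum_l \sum_q A i q * P q j k l * U j k l
      = \sum_q A i q * (\sum_j \sum_k \sum_l P q j k l * U j k l).
    under [RHS]eq_bigr do rewrite mulr_sumr.
    rewrite [RHS]exchange_big; apply: eq_bigr => j _.
    under [RHS]eq_bigr do rewrite mulr_sumr.
    rewrite [RHS]exchange_big; apply: eq_bigr => k _.
    under [RHS]eq_bigr do rewrite mulr_sumr.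
    rewrite [RHS]exchange_big; apply: eq_bigr => l _.
    by apply: eq_bigr => q _; rewrite mulrA.
  have e2 : \sum_j \sum_k \sum_l \sum_q A j q * P i q k l * U j k l = t2.
    apply: eq_bigr => j _; under [RHS]eq_bigr do rewrite mulr_sumr.
    rewrite [RHS]exchange_big; apply: eq_bigr => k _.
    under [RHS]eq_bigr do rewrite mulr_sumr.
    rewrite [RHS]exchange_big; apply: eq_bigr => l _.
    by apply: eq_bigr => q _; rewrite mulrA.
  have e3 : \sum_j \sum_k \sum_l \sum_q A k q * P i j q l * U j k l = t2.
    rewrite -e2 exchange_big; apply: eq_bigr => j _; apply: eq_bigr => k _.
    apply: eq_bigr => l _; apply: eq_bigr => q _.
    by rewrite (spin7_swap alg) /U raise3_skew12; ring.
  have e4 : \sum_j \sum_k \sum_l \sum_q A l q * P i j k q * U j k l = t2.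
    rewrite -e3; apply: eq_bigr => j _; rewrite exchange_big.
    apply: eq_bigr => k _; apply: eq_bigr => l _; apply: eq_bigr => q _.
    by rewrite spin7_skew34 /U raise3_skew23; ring.
  by rewrite e1 e2 e3 e4; ring.
have one (F : 'I_8 -> R) s : \sum_m F m * (m == s)%:R = F s.
  rewrite (bigD1 s) //= eqxx mulr1 big1 ?addr0 // => m ms.
  by rewrite (negPf ms) mulr0.
(* Here 42 = 6 (8 - 1); the term in P is a trace of a skew pair of indices against the symmetric [h]
   and vanishes. *)
have first q : \sum_j \sum_k \sum_l P q j k l * U j k l = 42 * G q b.
  under eq_bigr do rewrite raise3_contract.
  rewrite sumrB -mulr_sumr sumrB.
  under eq_bigr do rewrite eqxx.
  rewrite one big_const_ord.
  have -> : \sum_j 4 * (\sum_m h j m * P b m q j) = 0.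
    rewrite -mulr_sumr; set s := \sum_j _.
    suff : s = - s by lra.
    rewrite {1}/s exchange_big -sumrN; apply: eq_bigr => m _.
    rewrite -sumrN; apply: eq_bigr => j _.
    rewrite (spin7_swap alg b q m j) (spin7_skew34 b q j m) (spin7_swap alg b j q m).
    by rewrite (hC j m); ring.
  by rewrite iter_addr_0 (GC b q) mulr1; ring.
under eq_bigr do rewrite first.
have -> : t2 = 6 * \tr A * G i b - 6 * (A *m G) i b
             - 4 * contract12 P (h *m (A *m G) *m h) i b.
  transitivity (6 * (\sum_j \sum_q A j q * G b i * (q == j)%:R)
    - 6 * (\sum_j (\sum_q A j q * G b q) * (j == i)%:R)
    - 4 * \sum_j \sum_q A j q * \sum_m h j m * P b m i q).
    rewrite !mulr_sumr -!sumrB; apply: eq_bigr => j _.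
    rewrite mulr_suml !mulr_sumr -!sumrB; apply: eq_bigr => q _.
    by rewrite raise3_contract [q == j]eq_sym; ring.
  rewrite one; congr (_ - _ - _).
  - under eq_bigr do rewrite one.
    by rewrite -mulr_suml GC mulrA.
  - by rewrite mxE; congr (_ * _); apply: eq_bigr => q _; rewrite GC.
  have -> : h *m (A *m G) *m h = h *m A by rewrite !mulmxA -mulmxA Gh mulmx1.
  rewrite [in RHS]mxE; congr (_ * _).
  transitivity (\sum_m \sum_j \sum_q h m j * A j q * P m q i b); last first.
    apply: eq_bigr => m _; rewrite exchange_big; apply: eq_bigr => q _.
    by rewrite mxE mulr_suml.
  rewrite [RHS]exchange_big; apply: eq_bigr => j _; rewrite [RHS]exchange_big.
  apply: eq_bigr => q _; rewrite mulr_sumr; apply: eq_bigr => m _.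
  rewrite -(spin7_pair b m i q) -(spin7_pair m q i b).
  rewrite (spin7_skew34 i q m b) (spin7_swap alg i m q b).
  by rewrite (spin7_skew34 i m b q) (spin7_swap alg i b m q) (hC j m); ring.
rewrite [(A *m G) i b]mxE.
have -> : \sum_q A i q * (42 * G q b) = 42 * \sum_q A i q * G q b.
  by rewrite mulr_sumr; apply: eq_bigr => q _; ring.
ring.
Qed.

(** On Omega^2_7 the trace term vanishes and Phi(B) = -6 B, so the coefficient is 24 + 12 . 6 = 96.
    Contraction with P thus recovers B from its action on P. *)
Lemma omega7_deriv_act B i b : B^T = - B ->
  contract12 P (h *m B *m h) = - 6 *: B ->
  \sum_j \sum_k \sum_l deriv_act (B *m h) P i j k l * raise3 h P b j k l
  = 96 * B i b.
Proof.
move=> Bt B7; rewrite deriv_act_contract -(mulmxA B) hG mulmx1 B7 mxE.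
have tr0 : \tr (B *m h) = 0.
  suff : \tr (B *m h) = - \tr (B *m h) by lra.
  by rewrite -[LHS]mxtrace_tr trmx_mul ht Bt mulmxN trN mxtrace_mulC.
by rewrite tr0; ring.
Qed.

(** The infinitesimal stabilizer of P lies in Omega^2_21: contracting A.P = 0 with P gives 24 B + 18
    tr(A) G = 12 Phi(B), and once the trace is known to vanish this is the eigenvector equation. *)
Lemma deriv_act_eq0 A : (forall i j k l, deriv_act A P i j k l = 0) ->
  contract12 P (h *m (A *m G) *m h) = 2 *: (A *m G).
Proof.
move=> A0; set B := A *m G.
have C0 i b : 24 * B i b + 18 * \tr A * G i b
    - 12 * contract12 P (h *m B *m h) i b = 0.
  rewrite -deriv_act_contract big1 // => j _; rewrite big1 // => k _.
  by rewrite big1 // => l _; rewrite A0 mul0r.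
have skewC i b : contract12 P (h *m B *m h) i b = - contract12 P (h *m B *m h) b i.
  rewrite !mxE -sumrN; apply: eq_bigr => j _; rewrite -sumrN.
  by apply: eq_bigr => k _; rewrite -mulrN spin7_skew34.
(* Trace against [h]: Phi(B) is skew and drops out, while G has trace 8, so 24 tr(A) + 144 tr(A) =
   0. *)
have trA : \tr A = 0.
  have trB : \tr A = \sum_b \sum_i B b i * h i b.
    rewrite -[A]mulmx1 -Gh mulmxA.
    by apply: eq_bigr => i _; rewrite mxE.
  have trC : \sum_b \sum_i contract12 P (h *m B *m h) b i * h i b = 0.
    set s := \sum_b _; suff : s = - s by lra.
    rewrite {1}/s exchange_big -sumrN; apply: eq_bigr => i _; rewrite -sumrN.
    by apply: eq_bigr => b _; rewrite skewC hC mulNr.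
  have trG : \sum_b \sum_i G b i * h i b = 8.
    rewrite -[RHS](mxtrace1 R 8) -Gh.
    by apply: eq_bigr => i _; rewrite mxE.
  have : \sum_b \sum_i (24 * B b i + 18 * \tr A * G b i
      - 12 * contract12 P (h *m B *m h) b i) * h i b = 0.
    by rewrite big1 // => b _; rewrite big1 // => i _; rewrite C0 mul0r.
  under eq_bigr => b _.
    under eq_bigr do rewrite mulrBl mulrDl -!mulrA.
    rewrite sumrB big_split /= -!mulr_sumr; over.
  rewrite sumrB big_split /= -!mulr_sumr -trB trC trG.
  lra.
apply/matrixP => i b; have := C0 i b; rewrite trA => C0ib; rewrite [RHS]mxE; lra.
Qed.

Lemma omega7_unitE B : B^T = - B -> contract12 P (h *m B *m h) = - 6 *: B ->
  exists f : 'I_7 -> R, B = \sum_a f a *: K a.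
Proof.
move=> Bt; rewrite contract12_sharp Bt opprK => B7.
(* The hypothesis reads 2 B - S = -6 B, where S is the sum over the [K a]; hence B = S / 8. *)
exists (fun a => 8^-1 * \tr (h *m B *m h *m (K a)^T)).
under eq_bigr do rewrite -scalerA; rewrite -scaler_sumr.
move: B7; set S := \sum_a _ => B7.
by apply/matrixP => i j; have /matrixP/(_ i j) := B7; rewrite !mxE; lra.
Qed.

(** Expanding A and B in the [K a], the vanishing triple traces show that C is orthogonal to every
    [K c]; the correction in [contract12_sharp] disappears and 2 C is left. *)
Lemma omega7_commutator A B :
  A^T = - A -> contract12 P (h *m A *m h) = - 6 *: A ->
  B^T = - B -> contract12 P (h *m B *m h) = - 6 *: B ->
  let C := A *m h *m B - B *m h *m A in
  contract12 P (h *m C *m h) = 2 *: C.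
Proof.
move=> At A7 Bt B7 C.
have Ct : C^T = - C.
  by rewrite /C raddfB /= !trmx_mul ht At Bt !mulNmx !mulmxN !opprK !mulmxA opprB.
rewrite contract12_sharp Ct opprK big1 ?subr0 ?scaler_nat ?mulr2n // => c _.
rewrite [X in X *: _](_ : _ = 0) ?scale0r //.
have [f Af] := omega7_unitE At A7; have [f' Bf] := omega7_unitE Bt B7.
rewrite /C Af Bf.
have tr0 (a b : 'I_7) : \tr (h *m (K a *m h *m K b) *m h *m (K c)^T) = 0.
  by rewrite Kt mulmxN trN -mulmxA mxtrace_mulC !mulmxA (spin7_trace3 alg) oppr0.
have tr0s (f1 f2 : 'I_7 -> R) :
    \tr (h *m ((\sum_a f1 a *: K a) *m h *m (\sum_a f2 a *: K a)) *m h *m (K c)^T) = 0.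
  rewrite !mulmx_suml mulmx_sumr !mulmx_suml raddf_sum /= big1 // => a _.
  rewrite !mulmx_sumr !mulmx_suml raddf_sum /= big1 // => b _.
  by rewrite -!scalemxAl -!scalemxAr -!scalemxAl !mxtraceZ tr0 !mulr0.
by rewrite mulmxBr !mulmxBl raddfB /= !tr0s subr0.
Qed.

End Pointwise.

(** * Symmetry of second derivatives *)

Section MixedDerivatives.
Variables (R : realType) (V : normedModType R).
Implicit Types (f : V -> R) (u v x y : V).

Lemma derivable_line f y v (s : R) :
  derivable f (s *: v + y) v ->
  is_derive s 1 (fun r => f (r *: v + y)) ('D_v f (s *: v + y)).
Proof.
have E : (fun h : R => h^-1 *: (((fun r => f (r *: v + y)) \o shift s) (h *: 1)
    - f (s *: v + y)))
  = (fun h => h^-1 *: ((f \o shift (s *: v + y)) (h *: v) - f (s *: v + y))).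
  by apply/funext => h /=; rewrite [h *: 1]mulr1 scalerDl addrA.
by move=> df; split; rewrite /derivable /derive E.
Qed.

Lemma derive_MVT f y v (t : R) : 0 < t ->
  (forall s, 0 <= s <= t -> derivable f (s *: v + y) v) ->
  exists2 s, 0 <= s <= t & f (t *: v + y) - f y = t * 'D_v f (s *: v + y).
Proof.
move=> t0 df; have line s : s \in `[0, t]%R -> is_derive s 1 (fun r => f (r *: v + y))
    ('D_v f (s *: v + y)).
  by rewrite in_itv => st; apply/derivable_line/df.
pose F := fun r : R => f (r *: v + y).
have dF s : s \in `]0, t[%R -> is_derive s 1 F ('D_v f (s *: v + y)).
  by move=> st; apply: line; apply: subset_itv_oo_cc st.
have cF : {within `[0, t], continuous F}%classic.
  by apply: derivable_within_continuous => s /line [].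
have [s st] := MVT t0 dF cF.
rewrite /F scale0r add0r subr0 mulrC => ->; exists s => //.
by move: (subset_itv_oo_cc st); rewrite in_itv.
Qed.

Lemma derivable_shift f u w y :
  derivable f (w + y) u -> is_derive y u (fun z => f (w + z)) ('D_u f (w + y)).
Proof.
have E : (fun h : R => h^-1 *: (((fun z => f (w + z)) \o shift y) (h *: u)
    - f (w + y)))
  = (fun h => h^-1 *: ((f \o shift (w + y)) (h *: u) - f (w + y))).
  by apply/funext => h /=; rewrite addrCA.
by move=> df; split; rewrite /derivable /derive E.
Qed.

(** Two applications of the mean value theorem: first along u to the increment of f in the direction
    v, then along v to the derivative of f along u. *)
Lemma second_difference f u v x (t : R) : 0 < t ->
  (forall r s, 0 <= r <= t -> 0 <= s <= t ->
    let y := s *: v + (r *: u + x) in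
    derivable f y u /\ derivable ('D_u f) y v) ->
  exists r s, [/\ 0 <= r <= t, 0 <= s <= t &
    f (t *: v + (t *: u + x)) - f (t *: u + x) - (f (t *: v + x) - f x)
    = t * (t * 'D_v ('D_u f) (s *: v + (r *: u + x)))].
Proof.
move=> t0 df; pose g := (fun z => f (t *: v + z)) - f.
have tt : 0 <= t <= t by rewrite lexx ltW.
have t00 : 0 <= (0 : R) <= t by rewrite lexx ltW.
have dg r : 0 <= r <= t -> is_derive (r *: u + x) u g
    ('D_u f (t *: v + (r *: u + x)) - 'D_u f (r *: u + x)).
  move=> rt; have [df1 _] := df r t rt tt; have [df2 _] := df r 0 rt t00.
  move: df2; rewrite scale0r add0r => df2.
  exact: is_deriveB (derivable_shift df1) (derivableP df2).
have [r rt gr] : exists2 r, 0 <= r <= t &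
    g (t *: u + x) - g x = t * 'D_u g (r *: u + x).
  by apply: derive_MVT => // r /dg[].
have [s st gs] : exists2 s, 0 <= s <= t &
    'D_u f (t *: v + (r *: u + x)) - 'D_u f (r *: u + x)
    = t * 'D_v ('D_u f) (s *: v + (r *: u + x)).
  by apply: (derive_MVT (f := 'D_u f)) => // s st; have [] := df r s rt st.
exists r, s; split => //.
by rewrite -gs -(derive_val (is_derive := dg r rt)) -gr.
Qed.

(** Schwarz's theorem. The second difference is symmetric in u and v, so it equals t^2 times either
    mixed derivative, each at some point near x; continuity at x concludes. *)
Lemma deriveC f (U : set V) u v x : open U -> U x ->
  (forall y, U y -> derivable f y u) -> (forall y, U y -> derivable f y v) ->
  (forall y, U y -> derivable ('D_u f) y v) ->
  (forall y, U y -> derivable ('D_v f) y u) ->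
  {for x, continuous ('D_v ('D_u f))} -> {for x, continuous ('D_u ('D_v f))} ->
  'D_v ('D_u f) x = 'D_u ('D_v f) x.
Proof.
move=> oU Ux fu fv fuv fvu cuv cvu; apply/eqP; rewrite -subr_eq0 -normr_eq0.
rewrite eq_le normr_ge0 andbT; apply/ler_addgt0Pl => e e0; rewrite addr0.
have e20 : 0 < e / 2 by lra.
have nU : nbhs x U by exact: open_nbhs_nbhs.
have /cvgr_dist_lt/(_ _ e20) n1 := cuv.
have /cvgr_dist_lt/(_ _ e20) n2 := cvu.
have [d /= d0 dA] := (nbhs_ballP x _).1 (filterI nU (filterI n1 n2)).
(* The summand 1 keeps the denominator positive when u = v = 0; the factor 1/2 keeps all points of
   the parallelogram strictly inside the ball of radius d. *)
pose t := d / (`|u| + `|v| + 1) / 2.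
have uv0 : 0 < `|u| + `|v| + 1 by rewrite ltr_wpDl ?addr_ge0.
have t0 : 0 < t by rewrite !divr_gt0.
have A w w' r s : `|w| + `|w'| = `|u| + `|v| -> 0 <= r <= t -> 0 <= s <= t ->
    ball x d (s *: w + (r *: w' + x)).
  move=> ww' /andP[r0 rt] /andP[s0 st]; rewrite -ball_normE /=.
  have -> : x - (s *: w + (r *: w' + x)) = - (s *: w + r *: w').
    by rewrite addrA opprD addrCA subrr addr0.
  rewrite normrN (le_lt_trans (ler_normD _ _)) // !normrZ.
  rewrite !ger0_norm // (@le_lt_trans _ _ (t * (`|u| + `|v|))) //.
    by rewrite -ww' mulrDr lerD // ler_wpM2r.
  rewrite (@lt_le_trans _ _ (t * (`|u| + `|v| + 1) * 2)) //; last first.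
    by rewrite /t mulrAC divfK // divfK // lt0r_neq0.
  have := mulr_ge0 (ltW t0) (addr_ge0 (normr_ge0 u) (normr_ge0 v)).
  have := mulr_gt0 t0 uv0; rewrite !mulrDr mulr1; nra.
have UU w w' r s : `|w| + `|w'| = `|u| + `|v| -> 0 <= r <= t -> 0 <= s <= t ->
    U (s *: w + (r *: w' + x)).
  by move=> ww' rt st; have [] := dA _ (A w w' r s ww' rt st).
have [r [s [rt st ea]]] := second_difference t0 (fun r s rt st =>
  let Uy := UU v u r s (addrC _ _) rt st in conj (fu _ Uy) (fuv _ Uy)).
have [r' [s' [rt' st' eb]]] := second_difference t0 (fun r s rt st =>
  let Uy := UU u v r s erefl rt st in conj (fv _ Uy) (fvu _ Uy)).
have [_ [/= Aw _]] := dA _ (A v u r s (addrC _ _) rt st).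
have [_ [_ /= Aw']] := dA _ (A u v r' s' erefl rt' st').
(* Cancelling t twice identifies the two mixed derivatives at the intermediate points; each is
   within e/2 of its value at x. *)
have close (a b a' b' D D' : R) : D = t * (t * a') -> D' = t * (t * b') -> D = D' ->
    `|a - a'| < e / 2 -> `|b - b'| < e / 2 -> `|a - b| <= e.
  move=> -> -> /(mulfI (lt0r_neq0 t0))/(mulfI (lt0r_neq0 t0)) <- aa' ba'.
  have -> : a - b = (a - a') - (b - a') by ring.
  by rewrite (le_trans (ler_normB _ _)) // [leRHS]splitr lerD // ltW.
apply: close ea eb _ Aw Aw'.
by rewrite [t *: v + (_ + x)]addrCA; ring.
Qed.

End MixedDerivatives.

(** * Derivatives of matrices and tensors *)

Section DerivativeRules.
Variables (R : realType) (V : normedModType R).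
Implicit Types (x v : V).

Lemma derivable_bigsum (I : Type) (r : seq I) (Q : pred I) (F : I -> V -> R) x v :
  (forall i, derivable (F i) x v) ->
  derivable (fun y => \sum_(i <- r | Q i) F i y) x v.
Proof.
move=> dF; elim: r => [|i r IHr].
  under eq_fun do rewrite big_nil; exact: derivable_cst.
under eq_fun do rewrite big_cons; case: (Q i); last exact: IHr.
exact: derivableD (dF i) IHr.
Qed.

Lemma derivable_bigprod (I : Type) (r : seq I) (Q : pred I) (F : I -> V -> R) x v :
  (forall i, derivable (F i) x v) ->
  derivable (fun y => \prod_(i <- r | Q i) F i y) x v.
Proof.
move=> dF; elim: r => [|i r IHr].
  under eq_fun do rewrite big_nil; exact: derivable_cst.
under eq_fun do rewrite big_cons; case: (Q i); last exact: IHr.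
exact: derivableM (dF i) IHr.
Qed.

Lemma derive_bigsum (I : Type) (r : seq I) (Q : pred I) (F : I -> V -> R) x v :
  (forall i, derivable (F i) x v) ->
  'D_v (fun y => \sum_(i <- r | Q i) F i y) x = \sum_(i <- r | Q i) 'D_v (F i) x.
Proof.
move=> dF; elim: r => [|i r IHr].
  under eq_fun do rewrite big_nil; rewrite big_nil; exact: derive_cst.
under eq_fun do rewrite big_cons; rewrite big_cons.
case: (Q i); last exact: IHr.
rewrite -IHr; exact: deriveD (dF i) (derivable_bigsum (r := r) (Q := Q) dF).
Qed.

Lemma derive_mul (f g : V -> R) x v : derivable f x v -> derivable g x v ->
  'D_v (fun y => f y * g y) x = 'D_v f x * g x + f x * 'D_v g x.
Proof.
move=> df dg; transitivity (f x * 'D_v g x + g x * 'D_v f x); last by ring.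
exact: deriveM df dg.
Qed.

Lemma derive_mx_entry m n (M : V -> 'M[R]_(m, n)) x v i j : derivable M x v ->
  'D_v M x i j = 'D_v (fun y => M y i j) x.
Proof. by move=> /derive_mx ->; rewrite mxE. Qed.

Lemma derivable_mulmx m n p (M : V -> 'M[R]_(m, n)) (N : V -> 'M[R]_(n, p)) x v :
  derivable M x v -> derivable N x v -> derivable (fun y => M y *m N y) x v.
Proof.
move=> /derivable_mxP dM /derivable_mxP dN; apply/derivable_mxP => i j.
under eq_fun do rewrite mxE; apply: derivable_bigsum => k; exact: derivableM.
Qed.

Lemma derive_mulmx m n p (M : V -> 'M[R]_(m, n)) (N : V -> 'M[R]_(n, p)) x v :
  derivable M x v -> derivable N x v ->
  'D_v (fun y => M y *m N y) x = 'D_v M x *m N x + M x *m 'D_v N x.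
Proof.
move=> dM dN; have /derivable_mxP dM' := dM; have /derivable_mxP dN' := dN.
apply/matrixP => i j; rewrite derive_mx_entry; last exact: derivable_mulmx.
under eq_fun do rewrite mxE; rewrite derive_bigsum; last first.
  by move=> k; exact: derivableM.
rewrite !mxE -big_split; apply: eq_bigr => k _.
by rewrite derive_mul // !derive_mx_entry.
Qed.

Lemma derivable_det n (M : V -> 'M[R]_n) x v :
  derivable M x v -> derivable (fun y => \det (M y)) x v.
Proof.
move=> /derivable_mxP dM; apply: derivable_bigsum => s.
apply: derivableM; [exact: derivable_cst | exact: derivable_bigprod].
Qed.

(** By Cramer's rule the entries are quotients of polynomials in the entries of M. Invertibility is
    required near x because [invmx] returns its argument on singular matrices, where the cofactor
    formula fails. *)
Lemma derivable_invmx n (M : V -> 'M[R]_n) x v :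
  (\forall y \near x, M y \in unitmx) -> derivable M x v ->
  derivable (fun y => invmx (M y)) x v.
Proof.
move=> uM dM; have /derivable_mxP dM' := dM; apply/derivable_mxP => i j.
apply: (@near_eq_derivable _ _ _ (fun y => (\det (M y))^-1 * cofactor (M y) j i)).
  by near=> y; rewrite /invmx ifT ?mxE ?mxE //; near: y.
apply: derivableM.
  apply: derivableV; last exact: derivable_det.
  by rewrite -unitfE -unitmxE; exact: nbhs_singleton uM.
apply: derivableM; first exact: derivable_cst.
apply: derivable_det; apply/derivable_mxP => k l.
by under eq_fun do rewrite !mxE; exact: dM'.
Unshelve. all: by end_near. Qed.

Lemma derive_invmx n (M : V -> 'M[R]_n) x v :
  (\forall y \near x, M y \in unitmx) -> derivable M x v ->
  'D_v (fun y => invmx (M y)) x = - (invmx (M x) *m 'D_v M x *m invmx (M x)).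
Proof.
move=> uM dM; have dI := derivable_invmx uM dM.
have uMx := nbhs_singleton uM.
have : 'D_v (fun y => M y *m invmx (M y)) x = 0.
  rewrite -[RHS](derive_cst (1%:M : 'M[R]_n) x v); apply: near_eq_derive.
  by near=> y; rewrite mulmxV //; near: y.
rewrite derive_mulmx // => /(congr1 (mulmx (invmx (M x)))).
rewrite mulmx0 mulmxDr !mulmxA mulVmx // mul1mx => /eqP.
by rewrite addrC addr_eq0 => /eqP.
Unshelve. all: by end_near. Qed.

End DerivativeRules.

Section TensorDerivatives.
Variables (R : realType) (V : normedModType R) (x v : V).
Variables (A t : V -> 'M[R]_8) (S : 'I_8 -> 'I_8 -> 'I_8 -> 'I_8 -> V -> R).
Hypothesis dA : derivable A x v.
Hypothesis dt : derivable t x v.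
Hypothesis dS : forall i j k l, derivable (S i j k l) x v.

Local Notation at_ S y := (fun i j k l => S i j k l y).
Local Notation dS_ := (fun i j k l => 'D_v (S i j k l) x).

Let dAS a b i j k l : is_derive x v (fun y => A y a b * S i j k l y)
  ('D_v A x a b * S i j k l x + A x a b * 'D_v (S i j k l) x).
Proof.
have /derivable_mxP dA' := dA; rewrite derive_mx_entry //.
rewrite -(derive_mul (dA' a b) (@dS i j k l)); apply: derivableP.
exact: derivableM (dA' a b) (@dS i j k l).
Qed.

Let dact i j k l q := is_deriveD (is_deriveD (is_deriveD (dAS i q q j k l)
  (dAS j q i q k l)) (dAS k q i j q l)) (dAS l q i j k q).

Lemma derivable_deriv_act i j k l :
  derivable (fun y => deriv_act (A y) (at_ S y) i j k l) x v.
Proof. by apply: derivable_bigsum => q; have [] := dact i j k l q. Qed.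

Lemma derive_deriv_act i j k l :
  'D_v (fun y => deriv_act (A y) (at_ S y) i j k l) x
  = deriv_act ('D_v A x) (at_ S x) i j k l + deriv_act (A x) dS_ i j k l.
Proof.
rewrite derive_bigsum; last by move=> q; have [] := dact i j k l q.
rewrite -big_split; apply: eq_bigr => q _.
by have [_ ->] := dact i j k l q; rewrite /=; ring.
Qed.

Lemma derive_contract12 i j :
  'D_v (fun y => contract12 (at_ S y) (t y) i j) x
  = contract12 (at_ S x) ('D_v t x) i j + contract12 dS_ (t x) i j.
Proof.
have /derivable_mxP dt' := dt.
under eq_fun do rewrite mxE; rewrite !mxE -big_split derive_bigsum; last first.
  by move=> a; apply: derivable_bigsum => b; exact: derivableM (dt' a b) (@dS a b i j).
apply: eq_bigr => a _; rewrite -big_split derive_bigsum; last first.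
  by move=> b; exact: derivableM (dt' a b) (@dS a b i j).
by apply: eq_bigr => b _; rewrite derive_mul // derive_mx_entry.
Qed.

End TensorDerivatives.

(** * Commutators and contractions of the derivation action *)

Section TensorAlgebra.
Variable R : realFieldType.
Implicit Types (A B t : 'M[R]_8) (S : 'I_8 -> 'I_8 -> 'I_8 -> 'I_8 -> R).

Lemma deriv_actD A B S i j k l :
  deriv_act (A + B) S i j k l = deriv_act A S i j k l + deriv_act B S i j k l.
Proof. by rewrite -big_split; apply: eq_bigr => q _; rewrite !mxE /=; ring. Qed.

Lemma deriv_actB A B S i j k l :
  deriv_act (A - B) S i j k l = deriv_act A S i j k l - deriv_act B S i j k l.
Proof. by rewrite -sumrB; apply: eq_bigr => q _; rewrite !mxE /=; ring. Qed.

(** The terms of A.(B.S) in which A and B act on different slots form [cross]. They are unchanged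
    when A and B are exchanged along with the summation indices, so only the products within a
    single slot survive. *)
Lemma deriv_act_commutator A B S i j k l :
  deriv_act A (deriv_act B S) i j k l - deriv_act B (deriv_act A S) i j k l
  = deriv_act (A *m B - B *m A) S i j k l.
Proof.
pose cross (A B : 'M[R]_8) q r :=
    A i q * B j r * S q r k l + A i q * B k r * S q j r l + A i q * B l r * S q j k r
  + A j q * B i r * S r q k l + A j q * B k r * S i q r l + A j q * B l r * S i q k r
  + A k q * B i r * S r j q l + A k q * B j r * S i r q l + A k q * B l r * S i j q r
  + A l q * B i r * S r j k q + A l q * B j r * S i r k q + A l q * B k r * S i j r q.
have actE A' B' : deriv_act A' (deriv_act B' S) i j k l
    = deriv_act (A' *m B') S i j k l + \sum_q \sum_r cross A' B' q r.
  have -> : deriv_act (A' *m B') S i j k l = \sum_q \sum_r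
      (A' i q * B' q r * S r j k l + A' j q * B' q r * S i r k l
       + A' k q * B' q r * S i j r l + A' l q * B' q r * S i j k r).
    rewrite exchange_big; apply: eq_bigr => r _.
    by rewrite !mxE !mulr_suml -!big_split.
  rewrite -big_split; apply: eq_bigr => q _.
  rewrite !mulr_sumr -!big_split; apply: eq_bigr => r _.
  by rewrite /cross /=; ring.
rewrite !actE deriv_actB opprD addrACA [X in _ + X](_ : _ = 0) ?addr0 //.
apply/eqP; rewrite subr_eq0; apply/eqP; rewrite exchange_big.
by apply: eq_bigr => r _; apply: eq_bigr => q _; rewrite /cross; ring.
Qed.

(** The action on the two contracted slots is moved to t by transposition; the action on the two
    free slots becomes multiplication on either side. *)
Lemma contract12_deriv_act A S t :
  contract12 (deriv_act A S) t = contract12 S (A^T *m t + t *m A)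
    + A *m contract12 S t + contract12 S t *m A^T.
Proof.
have entryD (X Y Z : 'M[R]_8) i j : (X + Y + Z) i j = X i j + Y i j + Z i j.
  by rewrite !mxE.
apply/matrixP => i j; rewrite entryD [LHS]mxE; transitivity (
    \sum_a \sum_b \sum_q A a q * t a b * S q b i j
  + \sum_a \sum_b \sum_q t a b * A b q * S a q i j
  + \sum_a \sum_b \sum_q A i q * (t a b * S a b q j)
  + \sum_a \sum_b \sum_q t a b * S a b i q * A j q).
  rewrite -!big_split; apply: eq_bigr => a _; rewrite -!big_split.
  apply: eq_bigr => b _; rewrite -!big_split mulr_sumr.
  by apply: eq_bigr => q _; rewrite /=; ring.
congr (_ + _ + _).
- rewrite contract12D mxE [X in _ = X + _]mxE [X in _ = _ + X]mxE; congr (_ + _).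
    rewrite exchange_big [RHS]exchange_big; apply: eq_bigr => b _.
    rewrite exchange_big; apply: eq_bigr => q _; rewrite mxE mulr_suml.
    by apply: eq_bigr => a _; rewrite mxE.
  apply: eq_bigr => a _; rewrite exchange_big; apply: eq_bigr => q _.
  by rewrite mxE mulr_suml.
- rewrite mxE; under [RHS]eq_bigr do rewrite mxE mulr_sumr.
  rewrite [RHS]exchange_big; apply: eq_bigr => a _.
  under [RHS]eq_bigr do rewrite mulr_sumr.
  by rewrite [RHS]exchange_big.
- rewrite mxE; under [RHS]eq_bigr do rewrite !mxE mulr_suml.
  rewrite [RHS]exchange_big; apply: eq_bigr => a _.
  under [RHS]eq_bigr do rewrite mulr_suml.
  by rewrite [RHS]exchange_big.
Qed.

End TensorAlgebra.

(** * The identity at a point *)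

Section LocalIdentity.
Variables (R : realType) (V : normedModType R) (x : V).
Variables (G : V -> 'M[R]_8) (P : 'I_8 -> 'I_8 -> 'I_8 -> 'I_8 -> V -> R).

Local Notation h := (fun y => invmx (G y)).
Local Notation P_ y := (fun i j k l => P i j k l y).
Local Notation H := (invmx (G x)).

Hypothesis G_unit : \forall y \near x, G y \in unitmx.
Hypothesis G_sym : (G x)^T = G x.

Let addE (A B : 'M[R]_8) i j : (A + B) i j = A i j + B i j.
Proof. by rewrite mxE. Qed.

Let oppE (A : 'M[R]_8) i j : (- A) i j = - A i j.
Proof. by rewrite mxE. Qed.

Let scaleE c (A : 'M[R]_8) i j : (c *: A) i j = c * A i j.
Proof. by rewrite mxE. Qed.

Let move_terms (a b c d : R) : a + b = c + d -> a - c + (b - d) = 0.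
Proof. by rewrite addrACA -opprD => ->; rewrite subrr. Qed.

Let linE := (addE, oppE, scaleE).

(** Here n_u and n_v are the two covariant derivatives of T, r is the curvature, a - b = C is the
    commutator of the torsions, and each l is the image under Phi of the matching term. Elimination
    gives 8 (n_u - n_v) = 2 r - l_r - 16 C, the origin of 1/4, 1/8 and 2. *)
Let solve_linear (n_u n_v a b r l_u l_v l_c l_r : 'M[R]_8) :
  l_c = 2 *: (a - b) ->
  l_u + l_c = - 6 *: (n_u + (a - b)) -> l_v - l_c = - 6 *: (n_v - (a - b)) ->
  l_u - l_v - l_r + l_c = 2 *: (n_u - n_v - r + (a - b)) ->
  n_u - n_v = 4^-1 *: r - 8^-1 *: l_r + 2 *: b - 2 *: a.
Proof.
move=> /matrixP E1 /matrixP E2 /matrixP E3 /matrixP E4; apply/matrixP => i j.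
by move: (E1 i j) (E2 i j) (E3 i j) (E4 i j); rewrite !linE; lra.
Qed.

Let expand := (mulmxDl, mulmxDr, mulmxBl, mulmxBr, mulNmx, mulmxN, mulmxA).

Let GH : G x *m H = 1%:M. Proof. exact: mulmxV (nbhs_singleton G_unit). Qed.

Let HG : H *m G x = 1%:M. Proof. exact: mulVmx (nbhs_singleton G_unit). Qed.

Let mulGH (A : 'M[R]_8) : A *m G x *m H = A. Proof. by rewrite -mulmxA GH mulmx1. Qed.

Let mulHG (A : 'M[R]_8) : A *m H *m G x = A. Proof. by rewrite -mulmxA HG mulmx1. Qed.

Let Ht : H^T = H. Proof. by rewrite trmx_inv G_sym. Qed.

Lemma derive_metric_inv v (Gam : 'M[R]_8) : derivable G x v ->
  'D_v G x = Gam *m G x + G x *m Gam^T ->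
  'D_v h x = - (H *m Gam + Gam^T *m H).
Proof.
move=> dG GE; rewrite derive_invmx // GE !expand mulGH.
by rewrite HG mul1mx.
Qed.

(** With W = Gam + T' H, the matrix N + C equals D_v T - W T - T W^T, the derivative of T for a
    connection that preserves both the metric and P. Such a derivative keeps T in the eigenspace
    Omega^2_7. *)
Lemma omega7_derive v (T : V -> 'M[R]_8) (Gam T' : 'M[R]_8) :
  derivable G x v -> 'D_v G x = Gam *m G x + G x *m Gam^T ->
  (forall i j k l, derivable (P i j k l) x v) ->
  (forall i j k l, 'D_v (P i j k l) x = deriv_act (Gam + T' *m H) (P_ x) i j k l) ->
  derivable T x v -> T'^T = - T' ->
  (\forall y \near x, contract12 (P_ y) (h y *m T y *m h y) = - 6 *: T y) ->
  let N := 'D_v T x - Gam *m T x - T x *m Gam^T in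
  let C := T x *m H *m T' - T' *m H *m T x in
  contract12 (P_ x) (H *m (N + C) *m H) = - 6 *: (N + C).
Proof.
move=> dG GE dP PE dT T't T7 N C.
have dh := derivable_invmx G_unit dG.
have hE := derive_metric_inv dG GE.
pose t y := h y *m T y *m h y; pose W := Gam + T' *m H.
have dt : derivable t x v := derivable_mulmx (derivable_mulmx dh dT) dh.
have tE : 'D_v t x = ('D_v h x *m T x + H *m 'D_v T x) *m H + H *m T x *m 'D_v h x.
  by rewrite (derive_mulmx (derivable_mulmx dh dT) dh) (derive_mulmx dh dT).
have Wt : W^T = Gam^T - H *m T' by rewrite raddfD /= trmx_mul Ht T't mulmxN.
have DE : contract12 (P_ x) ('D_v t x) + contract12 (deriv_act W (P_ x)) (t x)
    = - 6 *: 'D_v T x.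
  apply/matrixP => i j; rewrite addE scaleE derive_mx_entry //.
  have -> : deriv_act W (P_ x) = fun i j k l => 'D_v (P i j k l) x.
    by do 4 apply/funext => ?; rewrite PE.
  rewrite -derive_contract12 //.
  have /derivable_mxP dT' := dT.
  transitivity ('D_v (fun y => -6 * T y i j) x).
    by apply: near_eq_derive; near=> y;
       rewrite [contract12 _ _](near T7 y) ?mxE //; near: y.
  exact: deriveZ (dT' i j).
move: DE; rewrite contract12_deriv_act addrA addrA -contract12D.
rewrite [contract12 _ (t x)](nbhs_singleton T7) Wt.
(* This is the derivative of T for W, computed with raised indices. *)
have -> : 'D_v t x + ((Gam^T - H *m T') *m t x + t x *m W) = H *m (N + C) *m H.
  rewrite tE hE /t /W /N /C !expand.
  by apply/matrixP => i j; rewrite !linE; ring.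
set Z := contract12 _ (_ *m _ *m _) => E.
apply/matrixP => i j; have := congr1 (fun M : 'M[R]_8 => M i j) E.
rewrite -scalemxAr -scalemxAl /W /N /C !expand /= !linE; lra.
Unshelve. all: by end_near. Qed.

Section TwoDirections.
Variables (u v : V) (Gam_u Gam_v T_u T_v : V -> 'M[R]_8) (K : 'I_7 -> 'M[R]_8).

Hypothesis alg : spin7_algebra (G x) H (P_ x) K.
Hypothesis dG_u : derivable G x u.
Hypothesis dG_v : derivable G x v.
Hypothesis GE_u : 'D_u G x = Gam_u x *m G x + G x *m (Gam_u x)^T.
Hypothesis GE_v : 'D_v G x = Gam_v x *m G x + G x *m (Gam_v x)^T.
Hypothesis dP_u : forall i j k l, derivable (P i j k l) x u.
Hypothesis dP_v : forall i j k l, derivable (P i j k l) x v.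
Hypothesis PC : forall i j k l,
  'D_v ('D_u (P i j k l)) x = 'D_u ('D_v (P i j k l)) x.
Hypothesis PE_u : \forall y \near x, forall i j k l,
  'D_u (P i j k l) y = deriv_act (Gam_u y + T_u y *m h y) (P_ y) i j k l.
Hypothesis PE_v : \forall y \near x, forall i j k l,
  'D_v (P i j k l) y = deriv_act (Gam_v y + T_v y *m h y) (P_ y) i j k l.
Hypothesis dGam_u : derivable Gam_u x v.
Hypothesis dGam_v : derivable Gam_v x u.
Hypothesis dT_u : derivable T_u x v.
Hypothesis dT_v : derivable T_v x u.
Hypothesis T_uE : \forall y \near x, (T_u y)^T = - T_u y /\
  contract12 (P_ y) (h y *m T_u y *m h y) = - 6 *: T_u y.
Hypothesis T_vE : \forall y \near x, (T_v y)^T = - T_v y /\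
  contract12 (P_ y) (h y *m T_v y *m h y) = - 6 *: T_v y.

Let N := ('D_v T_u x - Gam_v x *m T_u x - T_u x *m (Gam_v x)^T)
       - ('D_u T_v x - Gam_u x *m T_v x - T_v x *m (Gam_u x)^T).
Let C := T_u x *m H *m T_v x - T_v x *m H *m T_u x.
Let Rm := ('D_u Gam_v x - 'D_v Gam_u x + Gam_v x *m Gam_u x
           - Gam_u x *m Gam_v x) *m G x.

(* [Gam + T h] is a connection preserving [P], so by commutation of partial
   derivatives its curvature annihilates [P]. *)
Lemma contract12_curvature :
  contract12 (P_ x) (H *m (N - Rm + C) *m H) = 2 *: (N - Rm + C).
Proof.
have dh_u := derivable_invmx G_unit dG_u.
have dh_v := derivable_invmx G_unit dG_v.
pose W_u y := Gam_u y + T_u y *m h y; pose W_v y := Gam_v y + T_v y *m h y.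
have dW_u : derivable W_u x v := derivableD dGam_u (derivable_mulmx dT_u dh_v).
have dW_v : derivable W_v x u := derivableD dGam_v (derivable_mulmx dT_v dh_u).
pose F := 'D_v W_u x - 'D_u W_v x + (W_u x *m W_v x - W_v x *m W_u x).
(* Differentiating D_u P = W_u.P along v gives D_v D_u P = (D_v W_u).P + W_u.(W_v.P). Subtracting
   the same equation with u and v exchanged leaves F.P = 0. *)
have F0 i j k l : deriv_act F (P_ x) i j k l = 0.
  rewrite deriv_actD deriv_actB -deriv_act_commutator.
  have Pu : deriv_act (W_u x) (P_ x) = fun i j k l => 'D_u (P i j k l) x.
    by do 4 apply/funext => ?; rewrite (nbhs_singleton PE_u).
  have Pv : deriv_act (W_v x) (P_ x) = fun i j k l => 'D_v (P i j k l) x.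
    by do 4 apply/funext => ?; rewrite (nbhs_singleton PE_v).
  have Du : 'D_v ('D_u (P i j k l)) x = deriv_act ('D_v W_u x) (P_ x) i j k l
      + deriv_act (W_u x) (deriv_act (W_v x) (P_ x)) i j k l.
    rewrite Pv -derive_deriv_act //; apply: near_eq_derive.
    by near=> y; rewrite (near PE_u y) //; near: y.
  have Dv : 'D_u ('D_v (P i j k l)) x = deriv_act ('D_u W_v x) (P_ x) i j k l
      + deriv_act (W_v x) (deriv_act (W_u x) (P_ x)) i j k l.
    rewrite Pu -derive_deriv_act //; apply: near_eq_derive.
    by near=> y; rewrite (near PE_v y) //; near: y.
  exact: move_terms (etrans (esym Du) (etrans (PC i j k l) Dv)).
(* Multiplication by G lowers the second index of F: the pure Gamma terms give -Rm, the pure torsion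
   products give C, and the mixed terms with the derivatives of T and of [h] give N. *)
suff <- : F *m G x = N - Rm + C.
  exact: (deriv_act_eq0 alg F0).
have W_uE : 'D_v W_u x = 'D_v Gam_u x + ('D_v T_u x *m H + T_u x *m 'D_v h x).
  rewrite -(derive_mulmx dT_u dh_v).
  exact: (deriveD dGam_u (derivable_mulmx dT_u dh_v)).
have W_vE : 'D_u W_v x = 'D_u Gam_v x + ('D_u T_v x *m H + T_v x *m 'D_u h x).
  rewrite -(derive_mulmx dT_v dh_u).
  exact: (deriveD dGam_v (derivable_mulmx dT_v dh_u)).
rewrite /F W_uE W_vE (derive_metric_inv dG_u GE_u) (derive_metric_inv dG_v GE_v).
rewrite /W_u /W_v /N /Rm /C !expand !mulHG.
by apply/matrixP => i j; rewrite !linE; ring.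
Unshelve. all: by end_near. Qed.

Lemma torsion_curvature :
  N = 4^-1 *: Rm - 8^-1 *: contract12 (P_ x) (H *m Rm *m H)
      + 2 *: (T_v x *m H *m T_u x) - 2 *: (T_u x *m H *m T_v x).
Proof.
have [T_ut T_u7] := nbhs_singleton T_uE; have [T_vt T_v7] := nbhs_singleton T_vE.
have C2 : contract12 (P_ x) (H *m C *m H) = 2 *: C.
  exact: (omega7_commutator alg T_ut T_u7 T_vt T_v7).
pose L M := contract12 (P_ x) (H *m M *m H).
have LD M M' : L (M + M') = L M + L M' by rewrite /L mulmxDr mulmxDl contract12D.
have LN M : L (- M) = - L M by rewrite /L mulmxN mulNmx contract12N.
pose N_u := 'D_v T_u x - Gam_v x *m T_u x - T_u x *m (Gam_v x)^T.
pose N_v := 'D_u T_v x - Gam_u x *m T_v x - T_v x *m (Gam_u x)^T.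
have E_u : L (N_u + C) = - 6 *: (N_u + C).
  have T7 : \forall y \near x, contract12 (P_ y) (h y *m T_u y *m h y) = - 6 *: T_u y.
    by apply: filterS T_uE => y [].
  exact: (omega7_derive dG_v GE_v dP_v (nbhs_singleton PE_v) dT_u T_vt T7).
have E_v : L (N_v - C) = - 6 *: (N_v - C).
  have T7 : \forall y \near x, contract12 (P_ y) (h y *m T_v y *m h y) = - 6 *: T_v y.
    by apply: filterS T_vE => y [].
  (* Exchanging u and v reverses the sign of the commutator. *)
  rewrite /C opprB.
  exact: (omega7_derive dG_u GE_u dP_u (nbhs_singleton PE_u) dT_v T_ut T7).
have E_F : L (N_u - N_v - Rm + C) = 2 *: (N_u - N_v - Rm + C) := contract12_curvature.
have LC : L C = 2 *: C := C2.
rewrite LD in E_u; rewrite LD LN in E_v; rewrite 3!LD 2!LN in E_F.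
exact: (solve_linear LC E_u E_v E_F).
Qed.

End TwoDirections.

End LocalIdentity.

(** * Components in a chart *)

(** The relation E h E^T = 1 cancels the inverse metric between consecutive [K a], so the traces
    reduce to those of the constant matrices J_a. *)
Lemma spin7_algebra_coframe (R : realType) (E : 'M[R]_8) : E \in unitmx ->
  let G := E^T *m E in
  spin7_algebra G (invmx G) (fun i j k l => spin7_form E [tuple i; j; k; l])
    (fun a => E^T *m imag_unit R a *m E).
Proof.
move=> Eu G.
have Gh : G *m invmx G = 1%:M by rewrite mulmxV // unitmx_mul unitmx_tr Eu.
have EhE : E *m invmx G *m E^T = 1%:M by apply: mulmx1C; rewrite mulmxA.
pose K a := E^T *m (imag_unit R a *m E).
have KE a : E^T *m imag_unit R a *m E = K a by rewrite -mulmxA.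
have mulK a A : K a *m invmx G *m (E^T *m A) = E^T *m (imag_unit R a *m A).
  by rewrite -!mulmxA (mulmxA E) (mulmxA (E *m _)) EhE mul1mx.
have trE A : \tr (E^T *m (A *m E) *m invmx G) = \tr A.
  by rewrite -!mulmxA mxtrace_mulC -!mulmxA (mulmxA E) EhE mulmx1.
split=> //.
- by rewrite trmx_mul trmxK.
- by move=> a; rewrite !trmx_mul trmxK imag_unit_skew mulNmx mulmxN mulmxA.
- exact: spin7_formE.
- by move=> i j k l; rewrite /spin7_form !coframe4E /minor4 /minor2; ring.
- by move=> a b; rewrite !KE mulK mulmxA trE mxtrace_imag_unit2.
move=> a b c; rewrite !KE.
have -> : K a *m invmx G *m K b *m invmx G *m K c *m invmx G
    = K a *m invmx G *m (K b *m invmx G *m K c) *m invmx G by rewrite !mulmxA.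
rewrite !mulK (mulmxA (imag_unit R b)) (mulmxA (imag_unit R a)) trE.
exact: mxtrace_imag_unit3.
Qed.

(** * From tuple indices to matrices *)

Section ReplaceIndex.
Variable n : nat.
Implicit Types i j k l s : 'I_n.

Lemma replace_index3 i j k s :
  [/\ replace_index [tuple i; j; k] (inord 0) s = [tuple s; j; k],
      replace_index [tuple i; j; k] (inord 1) s = [tuple i; s; k] &
      replace_index [tuple i; j; k] (inord 2) s = [tuple i; j; s]].
Proof.
split; apply: eq_from_tnth => r; rewrite tnth_mktuple -val_eqE /= inordK //;
  by case: r => [[|[|[|//]]]] ?; rewrite !(tnth_nth s).
Qed.

Lemma replace_index4 i j k l s :
  [/\ replace_index [tuple i; j; k; l] (inord 0) s = [tuple s; j; k; l],
      replace_index [tuple i; j; k; l] (inord 1) s = [tuple i; s; k; l],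
      replace_index [tuple i; j; k; l] (inord 2) s = [tuple i; j; s; l] &
      replace_index [tuple i; j; k; l] (inord 3) s = [tuple i; j; k; s]].
Proof.
split; apply: eq_from_tnth => r; rewrite tnth_mktuple -val_eqE /= inordK //;
  by case: r => [[|[|[|[|//]]]]] ?; rewrite !(tnth_nth s).
Qed.

End ReplaceIndex.

Lemma big_inord (R : nmodType) n (F : 'I_n.+1 -> R) :
  \sum_(r < n.+1) F r = \sum_(0 <= r < n.+1) F (inord r).
Proof. by rewrite big_mkord; apply: eq_bigr => r _; rewrite inord_val. Qed.

Section Components.
Variables (R : realType) (g : components R 8 2).
Implicit Types (y : 'rV[R]_8) (m p q s t : 'I_8).

(** Rows carry the lower index and columns the upper one, so that [deriv_act] yields the Christoffel
    terms on covariant tensors. This is the transpose of the connection matrix on vector fields,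
    which reverses the products in [riemannE]. *)
Definition christoffel_mx m y : 'M[R]_8 := \matrix_(i, s) christoffel g s m i y.

Lemma cov_deriv3E (T : components R 8 3) m (i j k : 'I_8) y :
  cov_deriv g T m [tuple i; j; k] y = partial m (T [tuple i; j; k]) y
  - (\sum_s christoffel g s m i y * T [tuple s; j; k] y
     + \sum_s christoffel g s m j y * T [tuple i; s; k] y
     + \sum_s christoffel g s m k y * T [tuple i; j; s] y).
Proof.
rewrite /cov_deriv big_inord !big_nat_recl // big_geq // addr0 addrA.
congr (_ - (_ + _ + _)); apply: eq_bigr => s _;
  by have [r0 r1 r2] := replace_index3 i j k s;
     rewrite ?r0 ?r1 ?r2 (tnth_nth i) /= inordK.
Qed.

Lemma cov_deriv4E (S : components R 8 4) m (i j k l : 'I_8) y :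
  cov_deriv g S m [tuple i; j; k; l] y = partial m (S [tuple i; j; k; l]) y
  - deriv_act (christoffel_mx m y) (fun i j k l => S [tuple i; j; k; l] y) i j k l.
Proof.
rewrite /cov_deriv big_inord !big_nat_recl // big_geq // addr0 !addrA -!big_split.
congr (_ - _); apply: eq_bigr => s _; rewrite !mxE /=.
have [-> -> -> ->] := replace_index4 i j k l s.
by rewrite !(tnth_nth i) /= !inordK.
Qed.

Lemma contract12_sum (h B : 'M[R]_8) (b : 'I_8 -> 'I_8 -> R)
    (P : 'I_8 -> 'I_8 -> 'I_8 -> 'I_8 -> R) k l :
  h^T = h -> (forall i j, B i j = b i j) ->
  \sum_i \sum_j \sum_p \sum_q b i j * h i p * h j q * P p q k l
  = contract12 P (h *m B *m h) k l.
Proof.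
move=> ht Bb; have hC i j : h i j = h j i by rewrite -{1}ht mxE.
rewrite [RHS]mxE.
transitivity (\sum_p \sum_q \sum_j \sum_i b i j * h i p * h j q * P p q k l).
  under eq_bigr do rewrite exchange_big; rewrite exchange_big /=.
  apply: eq_bigr => p _; under eq_bigr do rewrite exchange_big.
  rewrite exchange_big /=; apply: eq_bigr => q _.
  by rewrite exchange_big.
apply: eq_bigr => p _; apply: eq_bigr => q _; rewrite mxE mulr_suml.
apply: eq_bigr => j _; rewrite mxE !mulr_suml; apply: eq_bigr => i _.
by rewrite Bb (hC i p); ring.
Qed.

Lemma riemannE p q k l y :
  derivable (christoffel_mx q) y (delta_mx 0 p) ->
  derivable (christoffel_mx p) y (delta_mx 0 q) ->
  riemann g p q k l y
  = (('D_(delta_mx 0 p) (christoffel_mx q) y - 'D_(delta_mx 0 q) (christoffel_mx p) y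
      + christoffel_mx q y *m christoffel_mx p y
      - christoffel_mx p y *m christoffel_mx q y) *m metric_mx g y) k l.
Proof.
move=> dq dp.
have fieldE i j : cov_deriv_field g j (coord_field i)
    = fun s z => christoffel g s j i z.
  apply/funext => s; apply/funext => z; rewrite /cov_deriv_field /coord_field.
  rewrite /partial derive_cst add0r (bigD1 i) //= eqxx mulr1 big1 ?addr0 // => t ti.
  by rewrite (negPf ti) mulr0.
rewrite /riemann !fieldE [RHS]mxE; apply: eq_bigr => s _.
rewrite [metric_mx g y s l]mxE [RHS]mulrC; congr (_ * _).
have mulE i j : \sum_t christoffel g s i t y * christoffel g t j k y
    = (christoffel_mx j y *m christoffel_mx i y) k s.
  by rewrite mxE; apply: eq_bigr => t _; rewrite !mxE mulrC.
have partialE i j : derivable (christoffel_mx j) y (delta_mx 0 i) ->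
    partial i (christoffel g s j k) y = 'D_(delta_mx 0 i) (christoffel_mx j) y k s.
  by move=> dG; rewrite derive_mx_entry //; under eq_fun do rewrite mxE.
rewrite /cov_deriv_field !mulE (partialE _ _ dq) (partialE _ _ dp).
have entryE (A B C D : 'M[R]_8) i j : (A - B + C - D) i j
    = A i j + C i j - (B i j + D i j) by rewrite !mxE; ring.
by rewrite entryE.
Qed.

End Components.

(** * Partial derivatives of smooth functions *)

Section SmoothFunctions.
Variables (R : realType) (n : nat) (U : set 'rV[R]_n) (f : 'rV[R]_n -> R).
Hypothesis f_smooth : smooth_on U f.

Lemma smooth_on_derivable i y : U y -> derivable f y (delta_mx 0 i).
Proof. by move=> Uy; have [_ /(_ i)[+ _]] := f_smooth 1; exact. Qed.

Lemma smooth_on_derivable2 i j y : U y ->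
  derivable (partial i f) y (delta_mx 0 j).
Proof. by move=> Uy; have [_ /(_ i)[_ [_ /(_ j)[+ _]]]] := f_smooth 2; exact. Qed.

Lemma smooth_on_continuous2 i j y : U y ->
  {for y, continuous (partial j (partial i f))}%classic.
Proof. by move=> Uy; have [_ /(_ i)[_ [_ /(_ j)[_ [+ _]]]]] := f_smooth 2; exact. Qed.

Lemma partialC i j y : open U -> U y ->
  partial j (partial i f) y = partial i (partial j f) y.
Proof.
move=> oU Uy; apply: (deriveC oU Uy).
- by move=> z Uz; exact: smooth_on_derivable.
- by move=> z Uz; exact: smooth_on_derivable.
- by move=> z Uz; exact: smooth_on_derivable2.
- by move=> z Uz; exact: smooth_on_derivable2.
- exact: smooth_on_continuous2.
- exact: smooth_on_continuous2.
Qed.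

End SmoothFunctions.

(** * The identity in one chart *)

Section Chart.
Variables (R : realType) (U : set 'rV[R]_8).
Variables (g : components R 8 2) (Phi : components R 8 4) (T : components R 8 3).
Hypothesis oU : open U.
Hypothesis g_smooth : forall I, smooth_on U (g I).
Hypothesis Phi_smooth : forall I, smooth_on U (Phi I).
Hypothesis frame : forall y, U y -> exists E : 'M[R]_8,
  [/\ E \in unitmx, forall I, Phi I y = spin7_form E I
    & forall i j, g [tuple i; j] y = \sum_a E a i * E a j].

Local Notation e m := (delta_mx 0 m : 'rV[R]_8).
Local Notation G := (metric_mx g).
Local Notation h y := (invmx (metric_mx g y)).
Local Notation P := (fun i j k l => Phi [tuple i; j; k; l]).
Local Notation P_ y := (fun i j k l => Phi [tuple i; j; k; l] y).
Local Notation Gam := (christoffel_mx g).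

Definition torsion_mx (m : 'I_8) (y : 'rV[R]_8) : 'M[R]_8 :=
  \matrix_(a, b) T [tuple m; a; b] y.

Hypothesis torsion : forall y, U y -> forall m : 'I_8,
  Omega2_7 (h y) (fun I => Phi I y) (fun a b => T [tuple m; a; b] y) /\
  forall i j k l : 'I_8,
    cov_deriv g Phi m [tuple i; j; k; l] y =
    \sum_(p < 8) \sum_(q < 8)
      (T [tuple m; i; p] y * h y p q * Phi [tuple q; j; k; l] y
       + T [tuple m; j; p] y * h y p q * Phi [tuple i; q; k; l] y
       + T [tuple m; k; p] y * h y p q * Phi [tuple i; j; q; l] y
       + T [tuple m; l; p] y * h y p q * Phi [tuple i; j; k; q] y).

Lemma spin7_algebra_chart y : U y ->
  exists K, spin7_algebra (G y) (h y) (P_ y) K.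
Proof.
move=> Uy; have [E [Eu PE gE]] := frame Uy.
have -> : G y = E^T *m E.
  by apply/matrixP => i j; rewrite !mxE gE; apply: eq_bigr => a _; rewrite mxE.
have -> : P_ y = fun i j k l => spin7_form E [tuple i; j; k; l].
  by do 4 apply/funext => ?; rewrite PE.
by exists (fun a => E^T *m imag_unit R a *m E); exact: spin7_algebra_coframe.
Qed.

Lemma metric_sym_chart y i j : U y -> g [tuple i; j] y = g [tuple j; i] y.
Proof.
move=> Uy; have [E [_ _ gE]] := frame Uy; rewrite !gE.
by apply: eq_bigr => a _; rewrite mulrC.
Qed.

Lemma near_chart y (Q : 'rV[R]_8 -> Prop) : U y -> (forall z, U z -> Q z) ->
  \forall z \near y, Q z.
Proof. by move=> Uy UQ; apply: filterS (open_nbhs_nbhs (conj oU Uy)). Qed.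

Lemma metric_unit_chart y : U y -> \forall z \near y, G z \in unitmx.
Proof.
move=> Uy; apply: near_chart Uy _ => z Uz.
by have [K /spin7_Gh/mulmx1_unit[]] := spin7_algebra_chart Uz.
Qed.

Lemma partial_metric_sym m i j y : U y ->
  partial m (g [tuple i; j]) y = partial m (g [tuple j; i]) y.
Proof.
move=> Uy; apply: near_eq_derive; apply: near_chart Uy _ => z.
exact: metric_sym_chart.
Qed.

Lemma derivable_metric_chart m y : U y -> derivable G y (e m).
Proof.
move=> Uy; apply/derivable_mxP => i j; under eq_fun do rewrite mxE.
exact: (smooth_on_derivable (@g_smooth [tuple i; j]) Uy).
Qed.

Lemma derivable_metric_inv_chart m y : U y ->
  derivable (fun z => h z) y (e m).
Proof.
move=> Uy.
exact: (derivable_invmx (metric_unit_chart Uy) (derivable_metric_chart Uy)).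
Qed.

Lemma metric_inv_sym y : U y -> (h y)^T = h y.
Proof.
by move=> Uy; have [K [Gt _ _ _ _ _ _]] := spin7_algebra_chart Uy; rewrite trmx_inv Gt.
Qed.

(** Christoffel symbols of the first kind: the column is the upper index of Gamma, lowered by the
    metric. *)
Definition christoffel_lower (m : 'I_8) (y : 'rV[R]_8) : 'M[R]_8 :=
  \matrix_(i, l) (2^-1 * (partial m (g [tuple i; l]) y
    + partial i (g [tuple m; l]) y - partial l (g [tuple m; i]) y)).

Lemma christoffel_mxE m y : U y -> Gam m y = christoffel_lower m y *m h y.
Proof.
move=> Uy; apply/matrixP => i s; rewrite !mxE /christoffel mulr_sumr.
apply: eq_bigr => l _; rewrite mxE /metric_inv -{1}(metric_inv_sym Uy) mxE; ring.
Qed.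

Lemma christoffel_sym s i j y : U y -> christoffel g s i j y = christoffel g s j i y.
Proof.
move=> Uy; congr (_ * _); apply: eq_bigr => l _.
by rewrite (partial_metric_sym l i j Uy); ring.
Qed.

Lemma derivable_christoffel m k y : U y -> derivable (Gam m) y (e k).
Proof.
move=> Uy.
apply: (@near_eq_derivable _ _ _ (fun z => christoffel_lower m z *m h z)).
  by apply: near_chart Uy _ => z Uz; rewrite christoffel_mxE.
apply: (derivable_mulmx _ (derivable_metric_inv_chart Uy)).
apply/derivable_mxP => i l; under eq_fun do rewrite mxE.
have d2 a b c := smooth_on_derivable2 (i := a) (j := k) (@g_smooth [tuple b; c]) Uy.
exact: (derivableM (derivable_cst _ _ _)
  (derivableB (derivableD (d2 m i l) (d2 i m l)) (d2 l m i))).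
Qed.

(** Compatibility with the metric. In [christoffel_lower] the last two terms are skew in i and l, so
    adding the transpose leaves only the derivative of g_il. *)
Lemma derive_metric m y : U y ->
  'D_(e m) G y = Gam m y *m G y + G y *m (Gam m y)^T.
Proof.
move=> Uy; have [K [Gt Gh _ _ _ _ _]] := spin7_algebra_chart Uy.
have -> : G y *m (Gam m y)^T = (Gam m y *m G y)^T by rewrite trmx_mul Gt.
have -> : Gam m y *m G y = christoffel_lower m y.
  by rewrite christoffel_mxE // -mulmxA (mulmx1C Gh) mulmx1.
apply/matrixP => i l; rewrite derive_mx_entry; last exact: derivable_metric_chart.
rewrite !mxE (partial_metric_sym m l i Uy) (partial_metric_sym l m i Uy).
rewrite (partial_metric_sym i m l Uy).
have -> : 'D_(e m) (fun z => G z i l) y = partial m (g [tuple i; l]) y.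
  by under eq_fun do rewrite mxE.
by field.
Qed.

Lemma torsion_mx_omega7 m y : U y -> (torsion_mx m y)^T = - torsion_mx m y /\
  contract12 (P_ y) (h y *m torsion_mx m y *m h y) = - 6 *: torsion_mx m y.
Proof.
move=> Uy; have [[Tskew T7] _] := torsion Uy m; split.
  by apply/matrixP => a b; rewrite !mxE Tskew.
apply/matrixP => i j; rewrite [RHS]mxE [torsion_mx m y i j]mxE -T7.
rewrite -(contract12_sum (b := fun a b => T [tuple m; a; b] y)) //.
  exact: metric_inv_sym.
by move=> a b; rewrite mxE.
Qed.

Lemma partial_spin7 m y i j k l : U y ->
  'D_(e m) (Phi [tuple i; j; k; l]) y
  = deriv_act (Gam m y + torsion_mx m y *m h y) (P_ y) i j k l.
Proof.
move=> Uy; have [_ /(_ i j k l)] := torsion Uy m.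
rewrite cov_deriv4E deriv_actD => E.
rewrite addrC; apply/eqP; rewrite -subr_eq; apply/eqP; apply: etrans E _.
rewrite exchange_big; apply: eq_bigr => q _.
by rewrite !mxE !mulr_suml -!big_split; apply: eq_bigr => p _; rewrite !mxE.
Qed.

(** [torsion_tensor] is a pointwise condition, so differentiability has to be derived: by
    [omega7_deriv_act], T is 1/96 times a contraction of derivatives of Phi, Christoffel symbols and
    the inverse metric. *)
Lemma derivable_torsion m k y : U y -> derivable (torsion_mx m) y (e k).
Proof.
move=> Uy; apply/derivable_mxP => i b.
apply: (@near_eq_derivable _ _ _ (fun z => 96^-1 * \sum_j \sum_k \sum_l
    ('D_(e m) (Phi [tuple i; j; k; l]) z - deriv_act (Gam m z) (P_ z) i j k l)
    * raise3 (h z) (P_ z) b j k l)).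
  apply: near_chart Uy _ => z Uz; have [Tt T7] := torsion_mx_omega7 m Uz.
  have [K alg] := spin7_algebra_chart Uz.
  have E j k' l : deriv_act (torsion_mx m z *m h z) (P_ z) i j k' l
      = 'D_(e m) (Phi [tuple i; j; k'; l]) z - deriv_act (Gam m z) (P_ z) i j k' l.
    by rewrite partial_spin7 // deriv_actD [RHS]addrC addKr.
  have T_E := omega7_deriv_act alg i b Tt T7.
  have n96 : 96 != 0 :> R by rewrite pnatr_eq0.
  apply: (mulfI n96); rewrite mulVKf // -T_E.
  by do 3 (apply: eq_bigr => ? _); rewrite E.
have dP i j k' l := smooth_on_derivable (i := k) (@Phi_smooth [tuple i; j; k'; l]) Uy.
have dh := derivable_metric_inv_chart (m := k) Uy; have /derivable_mxP dh' := dh.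
apply: (derivableM (derivable_cst _ _ _)).
apply: derivable_bigsum => j; apply: derivable_bigsum => k'.
apply: derivable_bigsum => l; apply: derivableM.
  apply: derivableB.
    exact: (smooth_on_derivable2 (i := m) (j := k) (@Phi_smooth _) Uy).
  exact: derivable_deriv_act (derivable_christoffel Uy) dP _ _ _ _.
apply: derivable_bigsum => j'; apply: (derivableM (dh' _ _)).
have /derivable_mxP : derivable
    (fun z => h z *m (\matrix_(k', l') P_ z b j' k' l') *m h z) y (e k).
  apply: (derivable_mulmx (derivable_mulmx dh _) dh).
  by apply/derivable_mxP => k1 l1; under eq_fun do rewrite mxE; exact: dP.
exact.
Qed.

Lemma torsion_curvature_chart y p q (a b : 'I_8) : U y ->
  cov_deriv g T q [tuple p; a; b] y - cov_deriv g T p [tuple q; a; b] y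
  = 4^-1 * riemann g p q a b y
    - 8^-1 * (\sum_(i < 8) \sum_(j < 8) \sum_(c < 8) \sum_(d < 8)
        riemann g p q i j y * h y i c * h y j d * Phi [tuple c; d; a; b] y)
    + 2 * (\sum_(m < 8) \sum_(n < 8)
        T [tuple q; a; m] y * h y m n * T [tuple p; n; b] y)
    - 2 * (\sum_(m < 8) \sum_(n < 8)
        T [tuple p; a; m] y * h y m n * T [tuple q; n; b] y).
Proof.
move=> Uy; have [K alg] := spin7_algebra_chart Uy.
have dP m i j k l := smooth_on_derivable (i := m) (@Phi_smooth [tuple i; j; k; l]) Uy.
have PC i j k l := partialC (@Phi_smooth [tuple i; j; k; l]) p q oU Uy.
have dPhi m : \forall z \near y, forall i j k l,
    'D_(e m) (Phi [tuple i; j; k; l]) z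
    = deriv_act (Gam m z + torsion_mx m z *m h z) (P_ z) i j k l.
  by apply: near_chart Uy _ => z Uz i j k l; exact: partial_spin7.
have T7 m := near_chart Uy (torsion_mx_omega7 m).
have dT m k := derivable_torsion (m := m) (k := k) Uy.
have dGam m k := derivable_christoffel (m := m) (k := k) Uy.
have := torsion_curvature (metric_unit_chart Uy) (spin7_sym alg) alg
  (derivable_metric_chart Uy) (derivable_metric_chart Uy)
  (derive_metric p Uy) (derive_metric q Uy) (dP p) (dP q) PC
  (dPhi p) (dPhi q) (dGam p q) (dGam q p) (dT p q) (dT q p) (T7 p) (T7 q).
set Rm := (_ *m G y) => /matrixP/(_ a b) E.
have RmE i j : Rm i j = riemann g p q i j y by rewrite riemannE.
have sumE m n : \sum_(m' < 8) \sum_(n' < 8)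
    T [tuple m; a; m'] y * h y m' n' * T [tuple n; n'; b] y
    = (torsion_mx m y *m h y *m torsion_mx n y) a b.
  rewrite exchange_big mxE; apply: eq_bigr => n' _; rewrite mxE mulr_suml.
  by apply: eq_bigr => m' _; rewrite !mxE.
(* The matrix formula treats only the two skew indices of T. The Christoffel term of the direction
   index m is therefore added back; by symmetry of the Christoffel symbols it is the same for both
   covariant derivatives and cancels in their difference. *)
have covE m n : cov_deriv g T n [tuple m; a; b] y
    + \sum_s christoffel g s m n y * T [tuple s; a; b] y
    = ('D_(e n) (torsion_mx m) y - Gam n y *m torsion_mx m y
      - torsion_mx m y *m (Gam n y)^T) a b.
  have entryE (A B C : 'M[R]_8) : (A - B - C) a b = A a b - B a b - C a b.
    by rewrite !mxE.
  rewrite cov_deriv3E entryE derive_mx_entry //.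
  have -> : 'D_(e n) (fun z => torsion_mx m z a b) y = partial n (T [tuple m; a; b]) y.
    by under eq_fun do rewrite mxE.
  have -> : \sum_s christoffel g s n m y * T [tuple s; a; b] y
      = \sum_s christoffel g s m n y * T [tuple s; a; b] y.
    by apply: eq_bigr => s _; rewrite christoffel_sym.
  have -> : (Gam n y *m torsion_mx m y) a b
      = \sum_s christoffel g s n a y * T [tuple m; s; b] y.
    by rewrite mxE; apply: eq_bigr => s _; rewrite !mxE.
  have -> : (torsion_mx m y *m (Gam n y)^T) a b
      = \sum_s christoffel g s n b y * T [tuple m; a; s] y.
    by rewrite mxE; apply: eq_bigr => s _; rewrite !mxE mulrC.
  ring.
have curvE : \sum_(i < 8) \sum_(j < 8) \sum_(c < 8) \sum_(d < 8)
    riemann g p q i j y * h y i c * h y j d * Phi [tuple c; d; a; b] y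
    = contract12 (P_ y) (h y *m Rm *m h y) a b.
  exact: (contract12_sum (P_ y) a b (metric_inv_sym Uy) RmE).
rewrite curvE !sumE -RmE.
have -> : cov_deriv g T q [tuple p; a; b] y - cov_deriv g T p [tuple q; a; b] y
  = (cov_deriv g T q [tuple p; a; b] y
     + \sum_s christoffel g s p q y * T [tuple s; a; b] y)
  - (cov_deriv g T p [tuple q; a; b] y
     + \sum_s christoffel g s q p y * T [tuple s; a; b] y).
  have -> : \sum_s christoffel g s q p y * T [tuple s; a; b] y
      = \sum_s christoffel g s p q y * T [tuple s; a; b] y.
    by apply: eq_bigr => s _; rewrite christoffel_sym.
  ring.
have entryE (A B C D : 'M[R]_8) :
    (4^-1 *: A - 8^-1 *: B + 2 *: C - 2 *: D) a b
    = 4^-1 * A a b - 8^-1 * B a b + 2 * C a b - 2 * D a b by rewrite !mxE.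
rewrite !covE -entryE -E.
by rewrite [RHS]mxE; congr (_ + _); rewrite [RHS]mxE.
Qed.

End Chart.

Theorem theorem4p2 (R : realType) (M : smooth_manifold R 8)
    (Phi : tensor_components M 4) (g : tensor_components M 2)
    (T : tensor_components M 3)
    (hPhi : spin7_structure Phi) (hg : spin7_metric Phi g)
    (hT : torsion_tensor Phi g T)
    (c : chart R 8 M) (hc : atlas c) (x : 'rV[R]_8) (hx : chart_cod c x)
    (p q alpha beta : 'I_8) :
  let h := metric_inv (g c) x in
  cov_deriv (g c) (T c) q [tuple p; alpha; beta] x
  - cov_deriv (g c) (T c) p [tuple q; alpha; beta] x
  = 4^-1 * riemann (g c) p q alpha beta x
    - 8^-1 * (\sum_(i < 8) \sum_(j < 8) \sum_(a < 8) \sum_(b < 8)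
        riemann (g c) p q i j x * h i a * h j b
        * Phi c [tuple a; b; alpha; beta] x)
    + 2 * (\sum_(m < 8) \sum_(n < 8)
        T c [tuple q; alpha; m] x * h m n * T c [tuple p; n; beta] x)
    - 2 * (\sum_(m < 8) \sum_(n < 8)
        T c [tuple p; alpha; m] x * h m n * T c [tuple q; n; beta] x).
Proof.
have [[Phi_smooth _] _] := hPhi.1; have [[[g_smooth _] _ _] orthonormal] := hg.
apply: (torsion_curvature_chart (U := chart_cod c)) => //.
- exact: chart_cod_open.
- by move=> I; exact: g_smooth.
- by move=> I; exact: Phi_smooth.
(* The coframe provided by [spin7_metric] is at once adapted to [Phi] and orthonormal for [g], as
   [frame] requires. *)
- move=> y cy; have [E [[Eu PhiE] gE]] := orthonormal c y hc cy.
  by exists E.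
- by move=> y cy m; exact: (hT c y hc cy m).
Qed.
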